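(* Let $G$ be a finite simple graph with no isolated vertices and assume $\dim M(G)=1$, where $M(G)$ is the matching complex of $G$. (a) $M(G)$ is Cohen--Macaulay if and only if either (i) $G$ has exactly two connected components, each of which is either $K_3$ or a star graph, or (ii) $G$ is (up to isomorphism) in one of the families $\mathcal{G}_1,\mathcal{G}_2,\mathcal{G}_3$, or $G$ is the bowtie graph $B$. (b) $M(G)$ is Buchsbaum if and only if $G$ is a graph described in (a), or $G=K_4$, or $G=C_4$.
   Context: A matching in $G$ is a set of edges no two of which share an endpoint. $M(G)$ is the simplicial complex whose faces are all matchings of $G$ (its vertices are the edges of $G$); $\dim\sigma=|\sigma|-1$. A simplicial complex $\Delta$ is Buchsbaum if it is pure and for every nonempty face $\sigma$ the reduced homology $\tilde H_i(\mathrm{link}_\Delta\sigma)$ vanishes for all $i<\dim\Delta-|\sigma|$; it is Cohen--Macaulay if this vanishing holds also for $\sigma=\emptyset$. For a 1-dimensional $\Delta$ (a graph with at least one edge), this means: $\Delta$ is Buchsbaum iff it is a graph with no isolated vertices, and Cohen--Macaulay iff it is a connected graph. The star graph $S_n$ ($n\ge1$) has one center joined to $n$ leaves. Each family below is taken up to isomorphism and given by: vertices, required edges, optional edges (any subset may be included), and a set $U$ of vertices; one may moreover add any finite number (possibly zero) of new vertices, each joined to some nonempty subset of $U$ (and having no other neighbors). $\mathcal{G}_1$: vertices $1,\dots,5$; required $12,23,34,45$; optional $14,25$; $U=\{2,4\}$. $\mathcal{G}_2$: vertices $1,\dots,5$; required $12,23,13,34,45$; optional $14,24$; $U=\{4\}$.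 $\mathcal{G}_3$: vertices $1,\dots,5$; required $12,23,34,45,51$; optional $13,35,25,24,14$; $U=\emptyset$. Bowtie graph $B$: vertices $1,\dots,5$, edges $12,23,13,34,45,35$. *)

(* Defs.v *)
From mathcomp Require Import all_boot all_order all_algebra.

Set Implicit Arguments.
Unset Strict Implicit.
Unset Printing Implicit Defensive.

Import Order.TTheory GRing.Theory Num.Theory.
Local Open Scope ring_scope.

(* A simplicial complex with vertices in T is given by its set D of faces,
   the empty face included. Degrees and dimensions are integers, as the
   empty face has dimension -1. *)
Section Complexes.
Variable T : finType.
Implicit Types (D : {set {set T}}) (s t : {set T}) (i : int).

Definition simplicial_complex D :=
  set0 \in D /\ forall s t, t \in D -> s \subset t -> s \in D.

Definition face_dim s : int := #|s|%:Z - 1.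

Definition complex_dim D : int := (\max_(s in D) #|s|)%:Z - 1.

Definition facet D s : bool := maxset [pred t : {set T} | t \in D] s.

Definition pure D := forall s, facet D s -> face_dim s = complex_dim D.

Definition link D s : {set {set T}} :=
  [set t : {set T} | [disjoint t & s] & t :|: s \in D].

(* Chains are functions on all of {set T}; membership in the degree i chain
   module of D is a support condition. Faces are oriented by enum_rank. *)
Definition chain (R : comNzRingType) D i (c : {set T} -> R) :=
  forall s, c s != 0 -> s \in D /\ face_dim s = i.

Definition position s (x : T) : nat :=
  #|[set y in s | (enum_rank y < enum_rank x)%N]|.

(* The linear extension of s |-> \sum_(x in s) (-1) ^ (position s x) (s :\ x);
   on vertices this is the augmentation, so the homology is the reduced one. *)
Definition boundary (R : comNzRingType) (c : {set T} -> R) (t : {set T}) : R :=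
  \sum_(s : {set T}) \sum_(x in s | s :\ x == t) (-1) ^+ position s x * c s.

Definition reduced_homology_vanishes (R : comNzRingType) D i :=
  forall z : {set T} -> R, chain D i z -> (forall t, boundary z t = 0) ->
  exists2 b : {set T} -> R, chain D (i + 1) b & forall t, boundary b t = z t.

Definition link_vanishing (R : comNzRingType) D s :=
  forall i, i < complex_dim D - #|s|%:Z ->
  reduced_homology_vanishes R (link D s) i.

Definition Buchsbaum (R : comNzRingType) D :=
  pure D /\ forall s, s \in D -> s != set0 -> link_vanishing R D s.

Definition Cohen_Macaulay (R : comNzRingType) D :=
  Buchsbaum R D /\ link_vanishing R D set0.

End Complexes.

(* A finite simple graph is a symmetric irreflexive relation on a finType. *)
Definition graph_iso (V W : finType) (e : rel V) (d : rel W) :=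
  exists2 f : V -> W, bijective f & forall x y, d (f x) (f y) = e x y.

Definition no_isolated (V : finType) (e : rel V) := forall x, exists y, e x y.

Definition edge_set (V : finType) (e : rel V) : {set {set V}} :=
  [set [set p.1; p.2] | p in [set p : V * V | e p.1 p.2]].

Definition matching_complex (V : finType) (e : rel V) : {set {set {set V}}} :=
  [set M : {set {set V}} | (M \subset edge_set e) && trivIset M].

Lemma matching_complexP (V : finType) (e : rel V) :
  simplicial_complex (matching_complex e).
Proof.
split=> [|s t]; first by rewrite inE sub0set; apply/trivIsetP=> ? ?; rewrite inE.
rewrite !inE => /andP[te /trivIsetP tt] st; rewrite (subset_trans st te).
by apply/trivIsetP=> A B /(subsetP st) At /(subsetP st); apply: tt.
Qed.

Definition induced (V : finType) (e : rel V) (P : pred V) : rel {x : V | P x} :=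
  fun x y => e (val x) (val y).
Arguments induced {V} e P _ _.

Definition component (V : finType) (e : rel V) (x : V) :=
  induced e [pred y | connect e x y].
Arguments component {V} e x _ _.

Definition complete_graph (n : nat) : rel 'I_n := fun i j => i != j.

Definition star_graph (n : nat) : rel 'I_n.+1 :=
  fun i j => (i == ord0) != (j == ord0).

Definition cycle_graph (n : nat) : rel 'I_n :=
  fun i j => (j == i.+1 %% n :> nat)%N || (i == j.+1 %% n :> nat)%N.

(* Vertices are labelled from 1 in edge lists: i : 'I_5 carries label i.+1. *)
Definition list_graph (E : seq (nat * nat)) : rel 'I_5 :=
  fun i j => ((i.+1, j.+1) \in E) || ((j.+1, i.+1) \in E).

(* m new vertices are added, the k-th one being joined exactly to N k. *)
Definition attach (e : rel 'I_5) (m : nat) (N : 'I_m -> {set 'I_5}) :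
    rel ('I_5 + 'I_m)%type :=
  fun u v => match u, v with
  | inl i, inl j => e i j
  | inl i, inr k | inr k, inl i => i \in N k
  | inr _, inr _ => false
  end.
Arguments attach e {m} N _ _.

Definition in_family (required optional : seq (nat * nat)) (U : seq nat)
    (V : finType) (e : rel V) :=
  exists (O : seq (nat * nat)) (m : nat) (N : 'I_m -> {set 'I_5}),
  [/\ {subset O <= optional},
      forall k, N k != set0 /\ (forall i, i \in N k -> i.+1 \in U)
    & graph_iso e (attach (list_graph (required ++ O)) N)].

Definition in_G1 (V : finType) (e : rel V) :=
  in_family [:: (1, 2); (2, 3); (3, 4); (4, 5)]%N
            [:: (1, 4); (2, 5)]%N
            [:: 2; 4]%N e.

Definition in_G2 (V : finType) (e : rel V) :=
  in_family [:: (1, 2); (2, 3); (1, 3); (3, 4); (4, 5)]%N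
            [:: (1, 4); (2, 4)]%N
            [:: 4]%N e.

Definition in_G3 (V : finType) (e : rel V) :=
  in_family [:: (1, 2); (2, 3); (3, 4); (4, 5); (5, 1)]%N
            [:: (1, 3); (3, 5); (2, 5); (2, 4); (1, 4)]%N
            [::] e.

Definition bowtie : rel 'I_5 :=
  list_graph [:: (1, 2); (2, 3); (1, 3); (3, 4); (4, 5); (3, 5)]%N.

Definition two_K3_or_star_components (V : finType) (e : rel V) :=
  n_comp e V = 2%N /\
  forall x : V, graph_iso (component e x) (@complete_graph 3) \/
    exists2 n : nat, (1 <= n)%N &
      graph_iso (component e x) (@star_graph n).

Definition listed_graph (V : finType) (e : rel V) :=
  two_K3_or_star_components e \/
  [\/ in_G1 e, in_G2 e, in_G3 e | graph_iso e bowtie].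

(* Main.v *)
Require Import Defs.
From mathcomp Require Import all_boot all_order all_algebra.
From mathcomp Require Import zify ring.

Set Implicit Arguments.
Unset Strict Implicit.
Unset Printing Implicit Defensive.

Import Order.TTheory GRing.Theory Num.Theory.
Local Open Scope ring_scope.

(* For a 1-dimensional complex, Buchsbaum means that no vertex is isolated and
   Cohen-Macaulay means in addition that the complex is connected. So M(G) is
   Buchsbaum iff every edge of G is disjoint from some other edge.

   For such a G without three disjoint edges: a triangle with no edge disjoint
   from it forces K_4; a triangle abc and a disjoint edge dz leave the other
   vertices adjacent to d and z only, and give G_2, the bowtie, two components,
   or a 5-cycle; a 5-cycle spans G; and a graph with no triangle and no 5-cycle
   is covered by two vertices, which are not adjacent, so it is in G_1, two stars
   or C_4. In every listed graph a walk through disjoint edges leads from any edge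
   to a fixed one, whereas in K_4 and C_4 an edge is disjoint from a single other
   edge, so M(G) is disconnected there. *)

(** * Homology of 1-dimensional complexes *)

(** The ring [R] is arbitrary, so no ranks are available. Degree 0 is handled by a pairing: a
    function constant along edges is a cocycle and separates disconnected vertices, while on a
    connected complex chains with boundary [[x] - [v0]] are built by induction. After that only two
    first-order facts about [e] remain, [no_3matching] (the bound on the dimension) and
    [edges_extend] (the Buchsbaum condition), and the classification works with these alone.
    Connectedness quantifies over symmetric relations on vertices, so that walks in M(G) never
    involve sets of sets. As Cohen--Macaulay includes Buchsbaum, one classification serves both
    parts of the theorem. *)

Section Homology.
Variables (R : comNzRingType) (T : finType).
Implicit Types (D : {set {set T}}) (s t : {set T}) (x y : T).

(** The boundary matrix: the coefficient of the face [t] in the oriented boundary of [s]. *)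
Definition incidence s t : R := \sum_(x in s | s :\ x == t) (-1) ^+ position s x.

Lemma boundaryE (c : {set T} -> R) t :
  boundary c t = \sum_s incidence s t * c s.
Proof. by apply: eq_bigr => s _; rewrite mulr_suml. Qed.

Lemma boundary_sum (I : finType) (a : I -> R) (b : I -> {set T} -> R) t :
  boundary (fun s => \sum_i a i * b i s) t = \sum_i a i * boundary (b i) t.
Proof.
rewrite boundaryE.
under eq_bigr do rewrite mulr_sumr.
rewrite exchange_big; apply: eq_bigr => i _; rewrite boundaryE mulr_sumr.
by apply: eq_bigr => s _; rewrite mulrCA.
Qed.

Lemma boundaryD (b c : {set T} -> R) t :
  boundary (fun s => b s + c s) t = boundary b t + boundary c t.
Proof.
by rewrite !boundaryE -big_split; apply: eq_bigr => s _; rewrite mulrDr.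
Qed.

Lemma boundary_delta s (a : R) t :
  boundary (fun s' => (s' == s)%:R * a) t = incidence s t * a.
Proof.
rewrite boundaryE (bigD1 s) //= eqxx mul1r big1 ?addr0 // => s' /negbTE->.
by rewrite mul0r mulr0.
Qed.

Lemma boundary0 t : boundary (fun _ => 0 : R) t = 0.
Proof. by rewrite boundaryE big1 // => s _; rewrite mulr0. Qed.

Lemma incidence1 x t : incidence [set x] t = (t == set0)%:R.
Proof.
rewrite /incidence (eq_bigl [pred y | (y == x) && (t == set0)]); last first.
  move=> y; rewrite inE /=; case: eqP => //= ->.
  by rewrite setDv eq_sym.
case: eqP => _; last by rewrite big_pred0 // => y; rewrite /= andbF.
rewrite (eq_bigl (pred1 x)) => [|y]; last by rewrite /= andbT.
rewrite big_pred1_eq /position.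
rewrite (_ : [set _ in _ | _] = set0) ?cards0 ?expr0 //.
by apply/setP=> y; rewrite !inE; case: eqP => // ->; rewrite ltnn.
Qed.

Lemma setD2l x y : x != y -> [set x; y] :\ x = [set y].
Proof.
move=> xy; apply/setP=> z; rewrite !inE.
by case: (eqVneq z x) => //= ->; rewrite (negbTE xy).
Qed.

Lemma setD2r x y : x != y -> [set x; y] :\ y = [set x].
Proof. by rewrite setUC eq_sym => /setD2l. Qed.

(** Which end gets the plus sign depends on [enum_rank]. Later steps only have to undo that sign, so
    it stays an anonymous [sg] with [sg * sg = 1]. *)
Lemma incidence2 x y : x != y -> exists2 sg : R, sg * sg = 1 &
  forall t, incidence [set x; y] t = sg * ((t == [set y])%:R - (t == [set x])%:R).
Proof.
wlog lt_xy: x y / (enum_rank x < enum_rank y)%N => [wl xy|].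
  case: (ltngtP (enum_rank x) (enum_rank y)) => [/wl|lt_yx|/val_inj/enum_rank_inj].
  - exact.
  - have [|sg sg1 E] := wl y x lt_yx; first by rewrite eq_sym.
    exists (- sg) => [|t]; first by rewrite mulrNN.
    by rewrite setUC E mulNr -mulrN opprB.
  by move/eqP; rewrite (negbTE xy).
move=> xy; exists 1 => [|t]; rewrite mul1r // /incidence.
rewrite big_mkcondr big_setU1 ?inE //= big_set1 setD2l // setD2r //.
have -> : position [set x; y] x = 0%N.
  apply/eqP; rewrite cards_eq0; apply/eqP/setP=> z; rewrite !inE.
  by case: eqP => [->|_] /=; [rewrite ltnn|case: eqP => // -> /=; rewrite ltnNge ltnW].
have -> : position [set x; y] y = 1%N.
  rewrite /position (_ : [set _ in _ | _] = [set x]) ?cards1 //.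
  apply/setP=> z; rewrite !inE.
  by case: eqP => [->|_] /=; [rewrite lt_xy|case: eqP => // ->; rewrite ltnn].
rewrite expr0 expr1 ![t == _]eq_sym.
by do 2!case: ifP => _; rewrite ?subr0 ?sub0r ?addr0 ?add0r ?subrr.
Qed.

Lemma vanishing_low D i : i < - 1 -> reduced_homology_vanishes R D i.
Proof.
move=> i_lt z Cz _; exists (fun=> 0) => [s|t]; first by rewrite eqxx.
rewrite boundary0; case: (eqVneq (z t) 0) => [->//|/Cz[_]].
by rewrite /face_dim; lia.
Qed.

(** A cycle of degree -1 is a multiple of the empty face, which is the boundary of any single
    vertex. *)
Lemma vanishing_m1 D x : [set x] \in D -> reduced_homology_vanishes R D (-1).
Proof.
move=> xD z Cz _; exists (fun s => (s == [set x])%:R * z set0) => [s|t].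
  case: (eqVneq s [set x]) => [->|_]; last by rewrite mul0r eqxx.
  by rewrite /face_dim cards1.
rewrite boundary_delta incidence1; case: (eqVneq t set0) => [->|t0].
  by rewrite mul1r.
rewrite mul0r; case: (eqVneq (z t) 0) => [->//|/Cz[_]].
by move: t0; rewrite -cards_eq0 /face_dim; lia.
Qed.

(** The indicator of the empty face is a cycle. Without vertices every 0-chain is zero, so a filling
    would have boundary 0 at [set0] instead of 1, against [1 != 0] in [R]. *)
Lemma vertex_of_vanishing D :
  set0 \in D -> reduced_homology_vanishes R D (-1) -> exists x, [set x] \in D.
Proof.
move=> D0 /(_ (fun s => (s == set0)%:R))[s|t|b Cb /(_ set0)].
- by case: (eqVneq s set0) => [->|]; rewrite ?eqxx // /face_dim cards0.
- rewrite boundaryE big1 // => s _; case: (eqVneq s set0) => [->|_]; last exact: mulr0.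
  by rewrite /incidence big1 ?mul0r // => x; rewrite inE.
rewrite eqxx => b1; apply/existsP; apply/contraT => /existsPn D1.
move: b1; rewrite boundaryE big1 => [/eqP|s _]; first by rewrite eq_sym oner_eq0.
case: (eqVneq (b s) 0) => [->|/Cb[sD]]; first by rewrite mulr0.
rewrite /face_dim => ds; have /eqP/cards1P[x xs] : #|s| = 1%N by lia.
by move: (D1 x); rewrite -xs sD.
Qed.

(** [f] is a 0-cocycle: it pairs to zero with the boundary of any 1-chain. Pairing it with the cycle
    [[y] - [x]], which is such a boundary, yields [f y - f x = 0]. *)
Lemma vanishing_0_const D (f : T -> R) x y :
  reduced_homology_vanishes R D 0 ->
  (forall u v, [set u; v] \in D -> f u = f v) ->
  [set x] \in D -> [set y] \in D -> f x = f y.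
Proof.
move=> H0 fD xD yD.
have [s|t|b Cb bE] := H0 (fun s => (s == [set y])%:R - (s == [set x])%:R).
- case: (eqVneq s [set y]) => [->|_]; first by rewrite /face_dim cards1.
  case: (eqVneq s [set x]) => [->|_]; first by rewrite /face_dim cards1.
  by rewrite subrr eqxx.
- rewrite boundaryE; under eq_bigr do rewrite mulrBr.
  rewrite sumrB; apply/eqP; rewrite subr_eq0; apply/eqP.
  rewrite (bigD1 [set y]) //= [RHS](bigD1 [set x]) //= eqxx !big1 ?eqxx ?addr0 ?incidence1 //.
    by move=> s /negbTE->; rewrite mulr0.
  by move=> s /negbTE->; rewrite mulr0.
have pair w : \sum_v f v * (([set v] == [set w])%:R : R) = f w.
  rewrite (bigD1 w) //= eqxx mulr1 big1 ?addr0 // => v /negbTE vw.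
  by rewrite (inj_eq set1_inj) vw mulr0.
have: \sum_v f v * boundary b [set v] = 0.
  under eq_bigr do rewrite boundaryE mulr_sumr.
  rewrite exchange_big big1 // => s _.
  case: (eqVneq (b s) 0) => [->|/Cb[sD ds]].
    by rewrite big1 // => v _; rewrite !mulr0.
  have /eqP/cards2P[u [v [uv sE]]] : #|s| = 2%N by move: ds; rewrite /face_dim; lia.
  have [sg _ E] := incidence2 uv.
  rewrite (eq_bigr (fun w => sg * b s * (f w * ([set w] == [set v])%:R)
      - sg * b s * (f w * ([set w] == [set u])%:R))) => [|w _].
    by rewrite sumrB -!mulr_sumr !pair (fD u v) ?subrr -?sE.
  by rewrite sE E; ring.
under eq_bigr do rewrite bE mulrBr.
by rewrite sumrB !pair => /eqP; rewrite subr_eq0 => /eqP.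
Qed.

(** Each vertex [x] is joined to [v0] by a chain with boundary [[x] - [v0]]. The coefficients of a
    0-cycle sum to zero, so the cycle is a combination of these differences and is filled by the
    same combination of the chains. *)
Lemma vanishing_0 D v0 :
  (forall P : T -> Prop, (forall x y, [set x; y] \in D -> P x -> P y) -> P v0 ->
     forall x, [set x] \in D -> P x) ->
  reduced_homology_vanishes R D 0.
Proof.
move=> conn z Cz z0.
pose P x b := chain D 1 b /\
  forall t, boundary b t = (t == [set x])%:R - (t == [set v0])%:R :> R.
have /fin_all_exists[b bP] x : exists b, [set x] \in D -> P x b.
  case xD: ([set x] \in D); last by exists (fun=> 0).
  suff [b Pb]: exists b, P x b by exists b.
  apply: (conn (fun x => exists b, P x b)) (xD) => {x xD} [x y xyD [b [Cb bE]]|].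
    (* [[set x; x]] is the vertex itself, so the induction also meets degenerate edges. *)
    case: (eqVneq x y) => [<-|xy]; first by exists b.
    have [sg sg1 E] := incidence2 xy.
    (* The factor [sg] cancels the orientation sign, so the edge contributes exactly [[y] - [x]]. *)
    exists (fun s => b s + (s == [set x; y])%:R * sg); split=> [s|t].
      case: (eqVneq s [set x; y]) => [->|_].
        by rewrite /face_dim cards2 xy.
      by rewrite mul0r addr0; apply: Cb.
    by rewrite boundaryD boundary_delta bE E mulrAC sg1 mul1r addrC subrKA.
  exists (fun=> 0); split=> [s|t]; first by rewrite eqxx.
  by rewrite boundary0 subrr.
(* The boundary of [z] at the empty face is its augmentation. *)
have sz0 : \sum_x z [set x] = 0.
  rewrite -[RHS](z0 set0) boundaryE; apply/esym.
  rewrite (bigID [pred s : {set T} | #|s| == 1%N]) /= [X in _ + X]big1 ?addr0 => [|s s1].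
    pose h s := if [pick x in s] is Some x then x else v0.
    rewrite (reindex_onto (@set1 T) h) => [|s /cards1P[x ->]]; last first.
      by rewrite /h; case: pickP => [y /set1P->|/(_ x)] //; rewrite inE eqxx.
    apply: eq_big => x; last by rewrite incidence1 eqxx mul1r.
    rewrite cards1 /h; case: pickP => [y /set1P->|/(_ x)]; first by rewrite !eqxx.
    by rewrite inE eqxx.
  case: (eqVneq (z s) 0) => [->|/Cz[_]]; first exact: mulr0.
  by move: s1; rewrite /face_dim; lia.
exists (fun s => \sum_x z [set x] * b x s) => [s|t].
  case: (boolP [exists x, (z [set x] != 0) && (b x s != 0)]) => [|/existsPn bz0].
    by case/existsP=> x /andP[/Cz[/bP[Cb _] _] /Cb].
  rewrite big1 ?eqxx // => x _; apply/eqP; move: (bz0 x).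
  by rewrite negb_and !negbK => /orP[]/eqP->; rewrite ?mul0r ?mulr0.
rewrite boundary_sum.
rewrite (eq_bigr (fun x => z [set x] * (t == [set x])%:R - z [set x] * (t == [set v0])%:R)).
  rewrite sumrB -mulr_suml sz0 mul0r subr0.
  case: (boolP [exists x, t == [set x]]) => [/existsP[x /eqP->]|/existsPn t1].
    rewrite (bigD1 x) //= eqxx mulr1 big1 ?addr0 // => y /negbTE xy.
    by rewrite (inj_eq set1_inj) eq_sym xy mulr0.
  rewrite big1 => [|x _]; last by rewrite (negbTE (t1 x)) mulr0.
  case: (eqVneq (z t) 0) => [->//|/Cz[_]]; rewrite /face_dim => dt.
  have /eqP/cards1P[x xs] : #|t| = 1%N by lia.
  by move: (t1 x); rewrite xs eqxx.
move=> x _; case: (eqVneq (z [set x]) 0) => [->|/Cz[/bP[_ ->] _]].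
  by rewrite !mul0r subrr.
by rewrite mulrBr.
Qed.

(** * Criteria for complexes of dimension 1 *)

Section OneDimensional.
Variable D : {set {set T}}.
Hypotheses (scD : simplicial_complex D) (dimD : complex_dim D = 1).

Lemma card_face s : s \in D -> (#|s| <= 2)%N.
Proof.
move=> sD; have : (#|s| <= \max_(t in D) #|t|)%N by apply: leq_bigmax_cond.
by move: dimD; rewrite /complex_dim; lia.
Qed.

Lemma exists_edge : exists x y, x != y /\ [set x; y] \in D.
Proof.
have D0 : (0 < #|D|)%N by apply/card_gt0P; exists set0; case: scD.
have [s sD ms] : {s | s \in D & \max_(t in D) #|t| = #|s|}.
  exact: eq_bigmax_cond.
have /eqP/cards2P[x [y [xy sE]]] : #|s| = 2%N.
  by move: dimD; rewrite /complex_dim ms; lia.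
by exists x, y; rewrite -sE.
Qed.

(** Vanishing is asked for [i < 1 - #|s|] and is automatic below degree -1. So edges impose nothing,
    and the link of a vertex must contain a vertex. The same extension rules out facets of cardinal
    1, and an existing edge rules out the empty facet. *)
Lemma Buchsbaum_dim1 :
  Buchsbaum R D <-> forall x, [set x] \in D -> exists2 y, x != y & [set x; y] \in D.
Proof.
have [D0 subD] := scD; split=> [[_ lk] x xD|ext].
  have [||y] := @vertex_of_vanishing (link D [set x]).
  - by rewrite inE set0U xD -setI_eq0 set0I eqxx.
  - apply: lk => //; last by rewrite dimD cards1.
    by apply/set0Pn; exists x; rewrite inE.
  rewrite inE disjoints1 inE => /andP[yx yxD]; exists y; first by rewrite eq_sym.
  by rewrite setUC.
split=> [s /maxsetP[/= sD smax]|s sD s0 i].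
  suff: #|s| = 2%N by rewrite dimD /face_dim => ->.
  have := card_face sD; rewrite leq_eqVlt => /orP[/eqP//|].
  rewrite ltnS leq_eqVlt ltnS leqn0 => /orP[/cards1P[x sx]|].
    have [|y xy xyD] := ext x; first by rewrite -sx.
    have sub : s \subset [set x; y] by rewrite sx subsetUl.
    have /setP/(_ y) := smax _ xyD sub; rewrite sx !inE eqxx orbT.
    by rewrite eq_sym (negbTE xy).
  rewrite cards_eq0 => /eqP s0; have [x [y [xy xyD]]] := exists_edge.
  have sub : s \subset [set x; y] by rewrite s0 sub0set.
  by have /setP/(_ x) := smax _ xyD sub; rewrite s0 !inE eqxx.
rewrite dimD => i_lt; have [/vanishing_low//|i_ge] := ltP i (-1).
have s1 : #|s| = 1%N by move: s0; rewrite -cards_eq0; lia.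
have -> : i = -1 by lia.
have /eqP/cards1P[x sx] := s1.
have [|y xy xyD] := ext x; first by rewrite -sx.
by apply: (@vanishing_m1 _ y); rewrite inE sx disjoints1 inE eq_sym xy setUC.
Qed.

Lemma link0 : link D set0 = D.
Proof. by apply/setP=> s; rewrite inE setU0 -setI_eq0 setI0 eqxx. Qed.

Lemma Cohen_Macaulay_dim1 :
  Buchsbaum R D ->
  (forall P : T -> Prop, (forall x y, [set x; y] \in D -> P x -> P y) ->
     forall x y, [set x] \in D -> [set y] \in D -> P x -> P y) ->
  Cohen_Macaulay R D.
Proof.
move=> BD conn; split=> // i; rewrite dimD cards0 link0 => i_lt.
have [x [y [xy xyD]]] := exists_edge.
have xD : [set x] \in D by case: scD => _; apply; [exact: xyD|rewrite subsetUl].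
have [/vanishing_low//|] := ltP i (-1); rewrite le_eqVlt => /orP[/eqP<-|i_gt].
  exact: vanishing_m1 xD.
have -> : i = 0 by lia.
by apply: (@vanishing_0 _ x) => P PD Px z zD; apply: (conn P) Px.
Qed.

Lemma Cohen_Macaulay_const (f : T -> R) x y :
  Cohen_Macaulay R D -> (forall u v, [set u; v] \in D -> f u = f v) ->
  [set x] \in D -> [set y] \in D -> f x = f y.
Proof.
case=> _ lk; apply: vanishing_0_const; rewrite -link0; apply: lk.
by rewrite dimD cards0.
Qed.

End OneDimensional.
End Homology.

(** Disjointness of the edges [ab] and [cd], kept as four disequalities so that [congruence] can
    prove and use it. *)
Definition apart (V : Type) (a b c d : V) := [/\ a <> c, a <> d, b <> c & b <> d].

(** * Matching complexes *)

(* Connectedness of the complex M(G), as an induction principle along walks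
   through disjoint edges. *)
Definition edge_connected (V : Type) (e : rel V) :=
  forall P : V -> V -> Prop, (forall a b, P a b -> P b a) ->
    (forall a b c d, e a b -> e c d -> apart a b c d -> P a b -> P c d) ->
    forall a b c d, e a b -> e c d -> P a b -> P c d.

Definition edges_extend (V : Type) (e : rel V) :=
  forall a b, e a b -> exists c d, e c d /\ apart a b c d.

Definition no_3matching (V : Type) (e : rel V) :=
  forall a b c d x y, e a b -> e c d -> e x y ->
    apart a b c d -> apart a b x y -> apart c d x y -> False.

Section MatchingComplex.
Variables (V : finType) (e : rel V).
Hypotheses (e_sym : symmetric e) (e_irr : irreflexive e).
Implicit Types (a b c d x y : V) (A B : {set V}).

Lemma edge_setP A : reflect (exists x y, e x y /\ A = [set x; y]) (A \in edge_set e).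
Proof.
apply: (iffP imsetP) => [[[x y]]|[x [y [xy ->]]]]; first by rewrite inE; exists x, y.
by exists (x, y); rewrite ?inE.
Qed.

Lemma mem_edge_set a b : ([set a; b] \in edge_set e) = e a b.
Proof.
apply/edge_setP/idP => [[x [y [xy abE]]]|]; last by exists a, b.
have xNy : x != y by apply: contraTneq xy => ->; rewrite e_irr.
have := cards2 x y; rewrite -abE cards2 xNy => aNb.
have [] : x \in [set a; b] /\ y \in [set a; b] by rewrite abE !inE !eqxx orbT.
case/set2P=> xE /set2P[]yE; subst x y; rewrite // ?eqxx // in xNy xy *.
by rewrite e_sym.
Qed.

Lemma disjoint_set2 a b c d :
  reflect (apart a b c d) [disjoint [set a; b] & [set c; d]].
Proof.
rewrite disjoints_subset subUset !sub1set !inE !negb_or.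
apply: (iffP andP) => [[/andP[/eqP ? /eqP ?] /andP[/eqP ? /eqP ?]] //|[? ? ? ?]].
by split; apply/andP; split; apply/eqP.
Qed.

Lemma mem_matching1 A : ([set A] \in matching_complex e) = (A \in edge_set e).
Proof.
rewrite inE sub1set; case: (A \in _) => //=; apply/trivIsetP => B C.
by rewrite !inE => /eqP-> /eqP->; rewrite eqxx.
Qed.

Lemma mem_matching2 A B : A != B ->
  ([set A; B] \in matching_complex e) =
    [&& A \in edge_set e, B \in edge_set e & [disjoint A & B]].
Proof.
move=> AB; rewrite inE subUset !sub1set -andbA; congr [&& _, _ & _].
apply/trivIsetP/idP => [->//|dAB C D]; first by rewrite !inE eqxx.
  by rewrite !inE eqxx orbT.
by rewrite !inE => /orP[]/eqP-> /orP[]/eqP->; rewrite ?eqxx // disjoint_sym.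
Qed.

Section DimensionOne.
Hypothesis dimM : complex_dim (matching_complex e) = 1.
Let scM := matching_complexP e.

Lemma apart_neq a b c d : apart a b c d -> [set a; b] != [set c; d].
Proof.
case=> ac ad _ _; apply/eqP => /setP/(_ a); rewrite !inE eqxx /=.
by move=> /esym/orP[]/eqP.
Qed.

Lemma mem_matching_apart a b c d : apart a b c d ->
  ([set [set a; b]; [set c; d]] \in matching_complex e) = e a b && e c d.
Proof.
move=> abcd; rewrite mem_matching2 ?apart_neq // !mem_edge_set.
by rewrite (introT (disjoint_set2 _ _ _ _)) ?andbT.
Qed.

Lemma two_apart_edges : exists a b c d, [/\ e a b, e c d & apart a b c d].
Proof.
have [A [B [AB]]] := exists_edge scM dimM; rewrite mem_matching2 //.
case/and3P => /edge_setP[a [b [ab ->]]] /edge_setP[c [d [cd ->]]] /disjoint_set2 abcd.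
by exists a, b, c, d.
Qed.

Lemma matching_le2 : no_3matching e.
Proof.
move=> a b c d x y ab cd xy abcd abxy cdxy.
have: [set [set a; b]; [set c; d]] :|: [set [set x; y]] \in matching_complex e.
  rewrite inE; apply/andP; split.
    by rewrite !subUset !sub1set !mem_edge_set ab cd.
  apply/trivIsetP => A B; rewrite !inE -!orbA.
  by do 2![case/or3P=> /eqP->]; rewrite ?eqxx // => _;
    first [exact/disjoint_set2 | rewrite disjoint_sym; exact/disjoint_set2].
move/(card_face dimM); rewrite cardsU cards2 cards1 apart_neq //.
rewrite (_ : _ :&: _ = set0) ?cards0 //; apply/setP => A; rewrite !inE.
case: (eqVneq A [set x; y]) => [->|]; rewrite ?andbF // andbT.
by rewrite eq_sym (negbTE (apart_neq abxy)) eq_sym (negbTE (apart_neq cdxy)).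
Qed.

Lemma Buchsbaum_matching (R : comNzRingType) :
  Buchsbaum R (matching_complex e) <-> edges_extend e.
Proof.
rewrite Buchsbaum_dim1 //; split=> [ext a b ab|ext A].
  have [|B AB] := ext [set a; b]; first by rewrite mem_matching1 mem_edge_set.
  rewrite mem_matching2 // => /and3P[_ /edge_setP[c [d [cd ->]]] /disjoint_set2].
  by exists c, d.
rewrite mem_matching1 => /edge_setP[a [b [ab ->]]].
have [c [d [cd abcd]]] := ext a b ab.
by exists [set c; d]; rewrite ?apart_neq // mem_matching_apart // ab.
Qed.

Lemma Cohen_Macaulay_matching (R : comNzRingType) :
  edge_connected e -> Cohen_Macaulay R (matching_complex e).
Proof.
move=> conn.
have ext : edges_extend e.
  move=> a b ab; have [x [y [z [t [xy zt xyzt]]]]] := two_apart_edges.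
  (* [P] says that [uv] is [ab] or that [ab] has a disjoint edge, and it propagates along walks. If
     [ab] had no disjoint edge, the disjoint edges [xy] and [zt] would both equal [ab]. *)
  pose P u v := [set u; v] = [set a; b] \/ exists c d, e c d /\ apart a b c d.
  have symP u v : P u v -> P v u.
    case=> [uvE|]; [left|by right].
    by rewrite setUC.
  have stepP u v w s : e u v -> e w s -> apart u v w s -> P u v -> P w s.
    move=> uv ws /disjoint_set2 uvws [uvE|]; last by right.
    by right; exists w, s; split=> //; apply/disjoint_set2; rewrite -uvE.
  have Pab : P a b by left.
  have [xyE|//] := conn P symP stepP a b x y ab xy Pab.
  have [ztE|//] := conn P symP stepP a b z t ab zt Pab.
  by case/apart_neq/eqP: xyzt; rewrite xyE ztE.
apply: Cohen_Macaulay_dim1 => //; first exact/Buchsbaum_matching.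
move=> P PD A B; rewrite !mem_matching1.
move=> /edge_setP[a [b [ab ->]]] /edge_setP[c [d [cd ->]]].
apply: (conn (fun x y => P [set x; y])) => // [x y|x y z t xy zt xyzt];
  first by rewrite setUC.
by apply: PD; rewrite mem_matching_apart // xy.
Qed.

(** On four vertices an edge can only be disjoint from its complement. The indicator of the perfect
    matching [{ab, cd}] is thus constant along the edges of the complex, yet it is 1 at [ab] and 0
    at [bc]. A spanning path suffices, so K_4 and C_4 are covered together. *)
Lemma not_Cohen_Macaulay_4cycle (R : comNzRingType) a b c d :
  uniq [:: a; b; c; d] -> (forall x, x \in [:: a; b; c; d]) ->
  e a b -> e b c -> e c d -> ~ Cohen_Macaulay R (matching_complex e).
Proof.
move=> s_uniq sV ab bc cd CM.
have [ac ad bc' bd] : apart a b c d.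
  move: s_uniq; rewrite /= !inE !negb_or.
  by case/and4P=> /and3P[/eqP ? /eqP ? /eqP ?] /andP[/eqP ? /eqP ?] _ _; split.
pose f A : R := ((A == [set a; b]) || (A == [set c; d]))%:R.
have opp x y : e x y -> apart a b x y -> [set x; y] = [set c; d].
  move=> xy [ax ay bx by_].
  have: x <> y by move=> xyE; rewrite xyE e_irr in xy.
  move: (sV x) (sV y); rewrite !inE => /or4P[]/eqP? /or4P[]/eqP?; subst x y => //.
  by rewrite setUC.
have opp' x y : e x y -> apart c d x y -> [set x; y] = [set a; b].
  move=> xy [ax ay bx by_].
  have: x <> y by move=> xyE; rewrite xyE e_irr in xy.
  move: (sV x) (sV y); rewrite !inE => /or4P[]/eqP? /or4P[]/eqP?; subst x y => //.
  by rewrite setUC.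
have fE A B : A \in edge_set e -> [disjoint B & A] ->
    (B == [set a; b]) || (B == [set c; d]) -> (A == [set a; b]) || (A == [set c; d]).
  move=> /edge_setP[x [y [xy ->]]] dis /orP[]/eqP BE; rewrite BE in dis.
    by apply/orP; right; apply/eqP/opp => //; apply/disjoint_set2.
  by apply/orP; left; apply/eqP/opp' => //; apply/disjoint_set2.
have : f [set a; b] = f [set b; c].
  apply: (Cohen_Macaulay_const dimM CM) => [A B||];
    rewrite ?mem_matching1 ?mem_edge_set //.
  case: (eqVneq A B) => [->//|AB]; rewrite mem_matching2 // => /and3P[eA eB dAB].
  congr (nat_of_bool _)%:R; apply/idP/idP; apply: fE => //.
  by rewrite disjoint_sym.
rewrite /f eqxx /=; case: eqP => [/setP/(_ c)|_].
  by rewrite !inE eqxx orbT => /esym/orP[]/eqP ?; subst c.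
case: eqP => [/setP/(_ b)|_ /eqP]; last by rewrite /= oner_eq0.
by rewrite !inE eqxx => /esym/orP[]/eqP.
Qed.

End DimensionOne.
End MatchingComplex.

(** * Isomorphisms and the families *)

(** The backward map [g] labels the vertices of [e] by those of the model, which is what the case
    analyses produce. *)
Lemma graph_iso_of (V W : finType) (e : rel V) (d : rel W) (g : W -> V) :
  injective g -> (forall x, exists i, x = g i) ->
  (forall i j, d i j = e (g i) (g j)) -> graph_iso e d.
Proof.
move=> g_inj g_surj gE.
have [f fK] : exists f, forall x, g (f x) = x.
  by apply: (@fin_all_exists _ _ (fun x i => g i = x)) => x; have [i ->]
    := g_surj x; exists i.
exists f => [|x y]; last by rewrite gE !fK.
by exists g => // i; apply: g_inj.
Qed.

Lemma graph_iso_inverse (V W : finType) (e : rel V) (d : rel W) :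
  graph_iso e d -> exists g : W -> V,
    [/\ injective g, forall x, exists i, x = g i & forall i j, e (g i) (g j) = d i j].
Proof.
case=> f [g fK gK] fE; exists g; split=> [|x|i j]; first exact: can_inj gK.
  by exists (f x).
by rewrite -fE !gK.
Qed.

Lemma graph_iso_seq (V : finType) (e : rel V) (n : nat) (d : rel 'I_n) x0 s :
  size s = n -> uniq s -> (forall x, x \in s) ->
  (forall i j : 'I_n, d i j = e (nth x0 s i) (nth x0 s j)) -> graph_iso e d.
Proof.
move=> sn us sV dE; apply: (graph_iso_of (g := fun i : 'I_n => nth x0 s i)) => //.
  by move=> i j /eqP; rewrite nth_uniq ?sn // => /eqP/val_inj.
move=> x; have xs : (index x s < n)%N by rewrite -sn index_mem.
by exists (Ordinal xs); rewrite nth_index.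
Qed.

Lemma induced_iso_seq (V : finType) (e : rel V) (P : pred V) (n : nat) (d : rel 'I_n)
    x0 s :
  size s = n -> uniq s -> P =i s ->
  (forall i j : 'I_n, d i j = e (nth x0 s i) (nth x0 s j)) ->
  graph_iso (induced e P) d.
Proof.
move=> sn us sP dE.
have Ps (i : 'I_n) : P (nth x0 s i).
  by move: (sP (nth x0 s i)); rewrite mem_nth ?sn // => /idP.
apply: (graph_iso_of (g := fun i : 'I_n => exist _ (nth x0 s i) (Ps i))) => //.
  by move=> i j /(congr1 val)/eqP; rewrite /= nth_uniq ?sn // => /eqP/val_inj.
move=> [x Px]; have xs : (index x s < n)%N by rewrite -sn index_mem -sP.
by exists (Ordinal xs); apply: val_inj; rewrite /= nth_index // -sP.
Qed.

(** With no attachment vertices a new vertex would have an empty neighbourhood, so there is none.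
    This lets the bowtie be treated as a family. *)
Lemma in_family_rigid (req : seq (nat * nat)) (V : finType) (e : rel V) :
  in_family req [::] [::] e <-> graph_iso e (list_graph req).
Proof.
split=> [[O [m [N [O0 N0]]]]|[f [g fK gK] fE]].
  have m0 (k : 'I_m) : False.
    by have [/set0Pn[i iN] /(_ i iN)] := N0 k.
  case=> f [g fK gK] fE.
  pose h (u : 'I_5 + 'I_m) := if u is inl i then i else ord0.
  have hK : cancel h inl by case=> // k; case: (m0 k).
  exists (h \o f) => [|x y].
    by exists (g \o inl) => x /=; rewrite ?hK ?gK.
  rewrite -fE /=; case: (f x) => [i|k]; last by case: (m0 k).
  case: (f y) => [j|k]; last by case: (m0 k).
  by case: O O0 {fE} => [|q O /(_ q)]; [rewrite cats0|rewrite inE eqxx => /(_ isT)].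
exists [::], 0%N, (fun=> set0); split=> // [[]//|]; rewrite cats0.
exists (fun x => inl (f x)) => [|x y]; last exact: fE.
exists (fun u : 'I_5 + 'I_0 => if u is inl i then g i else g ord0) => //.
by case=> [i|[]//]; rewrite gK.
Qed.

(** * Families in terms of five named vertices *)

Section Located.
Variables (V : finType) (e : rel V).
Hypotheses (e_sym : symmetric e) (e_irr : irreflexive e) (e_noisol : no_isolated e).

(* a, b, c, d, z carry the labels 1, ..., 5, so p k has label k.+1. *)
Definition located (req opt : seq (nat * nat)) (U : seq nat) (a b c d z : V) :=
  let s := [:: a; b; c; d; z] in let p := nth a s in
  [/\ uniq s, all (fun q => e (p q.1.-1) (p q.2.-1)) req,
      forall i j, (i < 5)%N -> (j < 5)%N -> e (p i) (p j) ->
        ((i.+1, j.+1) \in req ++ opt) || ((j.+1, i.+1) \in req ++ opt)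
    & forall x y, e x y -> x \notin s -> exists i, [/\ (i < 5)%N, i.+1 \in U & y = p i]].

(** The chosen optional edges are those present in [e]; the new vertices are those outside [s], with
    their actual neighbourhoods. These lie in [U] by the last clause of [located] and are nonempty
    because no vertex is isolated. *)
Lemma in_family_of_located req opt U a b c d z :
  located req opt U a b c d z -> in_family req opt U e.
Proof.
rewrite /located; set s := [:: a; b; c; d; z]; set p := nth a s.
case=> s_uniq reqE edgeE outE.
pose A := [pred x | x \notin s].
pose g (u : 'I_5 + 'I_#|A|) := match u with inl i => p i | inr k => enum_val k end.
have gA (k : 'I_#|A|) : enum_val k \notin s by have := enum_valP k; rewrite inE.
have ps (i : nat) : (i < 5)%N -> p i \in s by move=> i5; rewrite mem_nth.
have out2 x y : x \notin s -> e x y -> y \in s.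
  by move=> xs xy; have [i [i5 _ ->]] := outE x y xy xs; apply: ps.
exists [seq q <- opt | e (p q.1.-1) (p q.2.-1)], #|A|.
exists (fun k => [set i : 'I_5 | e (p i) (enum_val k)]); split.
- by move=> q; rewrite mem_filter => /andP[].
- move=> k; split=> [|i]; last first.
    rewrite inE e_sym => /outE/(_ (gA k))[j [j5 jU /eqP]].
    by rewrite nth_uniq // => /eqP->.
  have [y ky] := e_noisol (enum_val k); apply/set0Pn.
  have [i [i5 _ yE]] := outE _ _ ky (gA k).
  by exists (Ordinal i5); rewrite inE e_sym /= -yE.
apply: (graph_iso_of (g := g)).
- move=> [i|k] [j|l] /=.
  + by move/eqP; rewrite nth_uniq // => /eqP/val_inj->.
  + by move=> kE; have := gA l; rewrite -kE ps.
  + by move=> kE; have := gA k; rewrite kE ps.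
  + by move/enum_val_inj->.
- move=> x; case xs: (x \in s).
    have i5 : (index x s < 5)%N by rewrite index_mem.
    by exists (inl (Ordinal i5)); rewrite /= /p nth_index.
  have xA : x \in A by rewrite inE xs.
  by exists (inr (enum_rank_in xA x)); rewrite /= enum_rankK_in.
move=> [i|k] [j|l] /=.
- rewrite /list_graph; apply/idP/idP => [|ij].
    have in_e q : q \in req ++ [seq q <- opt | e (p q.1.-1) (p q.2.-1)] ->
        e (p q.1.-1) (p q.2.-1).
      by rewrite mem_cat mem_filter => /orP[/(allP reqE)|/andP[]].
    by case/orP=> /in_e //; rewrite e_sym.
  by have := edgeE i j (ltn_ord i) (ltn_ord j) ij;
    rewrite !mem_cat !mem_filter /= ij e_sym ij.
- by rewrite inE.
- by rewrite inE e_sym.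
- by apply/esym/negbTE/negP => /(out2 _ _ (gA k)); apply/negP.
Qed.

(** The range check is there because [located] reads label [n] at position [n.-1]: a label 0 would
    be mistaken for 1, and a label above 5 would fall on the default of [nth]. *)
Lemma located_of_in_family req opt U :
  all (fun q => (0 < q.1 <= 5) && (0 < q.2 <= 5))%N req ->
  in_family req opt U e -> exists a b c d z, located req opt U a b c d z.
Proof.
move=> req5 [O [m [N [O_sub NU]]]] /graph_iso_inverse[g [g_inj g_surj gE]].
pose q i := g (inl (inord i)).
exists (q 0), (q 1), (q 2), (q 3), (q 4).
rewrite /located; set s := [:: _; _; _; _; _]; set p := nth (q 0) s.
have pE i : (i < 5)%N -> p i = q i by do 5![case: i => [//|i]].
have inordE i : (i < 5)%N -> (inord i : 'I_5) = i :> nat by move=> ?; rewrite inordK.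
split.
- apply/(uniqP (q 0)) => i j; rewrite !inE => i5 j5.
  rewrite -/p !pE // => /g_inj[/(congr1 val)/=].
  by rewrite !inordE.
- apply/allP => [[i j]] ij; have := allP req5 _ ij; rewrite /=.
  case: i j ij => [//|i] [|j] ij; rewrite ?andbF //= => /andP[i5 j5].
  by rewrite !pE // gE /= /list_graph !inordE // mem_cat ij.
- move=> i j i5 j5; rewrite !pE // gE /= /list_graph !inordE // !mem_cat.
  case/orP=> /orP[->|/O_sub->]; by rewrite ?orbT.
move=> x y; have [[i|k] ->] := g_surj x; last first.
  have [[j|l] ->] := g_surj y; rewrite gE //= => jN _.
  exists j; split=> //; first by have [_ /(_ j jN)] := NU k.
  by rewrite pE //= /q inord_val.
move=> _; case/negP; rewrite -[i]inord_val -/(q i) -pE //.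
by rewrite mem_nth.
Qed.

End Located.

Lemma uniq5P (T : eqType) (a b c d z : T) : uniq [:: a; b; c; d; z] <->
  [/\ a <> b, a <> c, a <> d & a <> z] /\ [/\ b <> c, b <> d & b <> z] /\
  [/\ c <> d, c <> z & d <> z].
Proof.
rewrite /= !inE !negb_or -!andbA andbT; split.
  by do 9![case/andP=> /eqP ?]; move/eqP=> ?; do !split.
case=> -[? ? ? ?] [[? ? ?] [? ? ?]].
by do 9![apply/andP; split; first exact/eqP]; apply/eqP.
Qed.

(** * Connectedness of M(G) for the listed graphs *)

Section Connected.
Variables (V : finType) (e : rel V).
Hypotheses (e_sym : symmetric e) (e_irr : irreflexive e) (e_noisol : no_isolated e).

(** Disjointness is symmetric, so a step transports [P] both ways and each edge need only be
    compared with one fixed edge [hk]. *)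
Lemma edge_connected_hub h k :
  (forall P : V -> V -> Prop, (forall x y, P x y <-> P y x) ->
    (forall x y z t, e x y -> e z t -> apart x y z t -> P x y <-> P z t) ->
    forall x y, e x y -> P x y <-> P h k) ->
  edge_connected e.
Proof.
move=> hub P symP stepP a b c d ab cd; have {}symP x y
  : P x y <-> P y x by split; apply: symP.
have {}stepP x y z t : e x y -> e z t -> apart x y z t -> P x y <-> P z t.
  by move=> xy zt [xz xt yz yt]; split; apply: stepP => //; split; apply: nesym.
by move=> /(hub P symP stepP a b ab); rewrite (hub P symP stepP c d cd).
Qed.

(** Every edge contains [b] or [d]. Edges [by] with [y <> z] miss [dz], and [bz] misses [cd]; edges
    [dy] with [y <> a] miss [ab], and [da] misses [bc]. The edges of the path [a b c d z] are linked
    to the hub [dz]. *)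
Lemma in_G1_connected : in_G1 e -> edge_connected e.
Proof.
case/located_of_in_family=> // a [b [c [d [z [s_uniq /and5P[/= ab bc cd dz _] edgeE outE]]]]].
have [[? ? ? ?] [[? bd ?] [? ? ?]]] := (uniq5P _ _ _ _ _).1 s_uniq.
have bdF : e b d = false by apply/negP => bdE; have
  := edgeE 1%N 3%N isT isT bdE; rewrite !inE.
have cover x y : e x y -> [\/ x = b, x = d, y = b | y = d].
  move=> xy; case xs: (x \in [:: a; b; c; d; z]); last first.
    have [i []] := outE x y xy (negbT xs).
    by case: i => [|[|[|[|[|//]]]]] //= _ _ ->; first [by constructor 3|by constructor 4].
  case ys: (y \in [:: a; b; c; d; z]); last first.
    have yx : e y x by rewrite e_sym.
    have [i []] := outE y x yx (negbT ys).
    by case: i => [|[|[|[|[|//]]]]] //= _ _ ->; first [by constructor 1|by constructor 2].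
  move/(nthP a): xs => [i i5 xE]; move/(nthP a): ys => [j j5 yE]; subst x y.
  have := edgeE i j i5 j5 xy.
  case: i {i5 xy} => [|[|[|[|[|i]]]]] //; case: j {j5} => [|[|[|[|[|j]]]]] //= _;
  first [by constructor 1|by constructor 2|by constructor 3|by constructor 4].
apply: (@edge_connected_hub d z) => P symP stepP.
have abdz : P a b <-> P d z by apply: stepP => //; split; congruence.
have bcdz : P b c <-> P d z by apply: stepP => //; split; congruence.
have abcd : P c d <-> P a b by apply: stepP => //; split; congruence.
have b_ y : e b y -> P b y <-> P d z.
  move=> b_y; have yd : y <> d by congruence.
  have yb : y <> b by move=> yb; rewrite yb e_irr in b_y.
  case: (eqVneq y z) => [yz|/eqP yz]; last by apply: stepP => //; split; congruence.
  apply: iff_trans abdz; apply: iff_trans abcd.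
  by apply: stepP => //; split; congruence.
have d_ y : e d y -> P d y <-> P d z.
  move=> dy; have yb : y <> b by move=> yb; rewrite yb e_sym bdF in dy.
  have yd : y <> d by move=> yd; rewrite yd e_irr in dy.
  case: (eqVneq y a) => [ya|/eqP ya].
    by apply: iff_trans bcdz; apply: stepP => //; split; congruence.
  by apply: iff_trans abdz; apply: stepP => //; split; congruence.
move=> x y xy; case: (cover x y xy) => ?; subst.
- exact: b_.
- exact: d_.
- by rewrite symP; apply: b_; rewrite e_sym.
- by rewrite symP; apply: d_; rewrite e_sym.
Qed.

(** The sides of the triangle [abc] miss the hub [dz]. Every other edge contains [d] and misses a
    side that avoids its second end. *)
Lemma in_G2_connected : in_G2 e -> edge_connected e.
Proof.
case/located_of_in_family=> // a [b [c [d [z [s_uniq /and5P[/= ab bc ac cd /andP[dz _]] edgeE outE]]]]].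
have [[? ? ? ?] [[? bd ?] [? ? ?]]] := (uniq5P _ _ _ _ _).1 s_uniq.
have cover x y : e x y -> [\/ x \in [:: a; b; c] /\ y \in [:: a; b; c], x = d | y = d].
  move=> xy; case xs: (x \in [:: a; b; c; d; z]); last first.
    have [i []] := outE x y xy (negbT xs).
    by case: i => [|[|[|[|[|//]]]]] //= _ _ ->; constructor 3.
  case ys: (y \in [:: a; b; c; d; z]); last first.
    have yx : e y x by rewrite e_sym.
    have [i []] := outE y x yx (negbT ys).
    by case: i => [|[|[|[|[|//]]]]] //= _ _ ->; constructor 2.
  move/(nthP a): xs => [i i5 xE]; move/(nthP a): ys => [j j5 yE]; subst x y.
  have := edgeE i j i5 j5 xy.
  case: i {i5 xy} => [|[|[|[|[|i]]]]] //=;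
  case: j {j5} => [|[|[|[|[|j]]]]] //= _;
  first [by constructor 2|by constructor 3|by constructor 1; rewrite !inE !eqxx ?orbT].
apply: (@edge_connected_hub d z) => P symP stepP.
have tri x y : e x y -> x \in [:: a; b; c] -> y \in [:: a; b; c] -> P x y <-> P d z.
  move=> xy; rewrite !inE => xs ys; apply: stepP => //.
  by case/or3P: xs => /eqP->; case/or3P: ys => /eqP->; split; congruence.
have abdz := tri a b ab; have acdz := tri a c ac; have bcdz := tri b c bc.
rewrite !inE !eqxx ?orbT in abdz acdz bcdz.
have d_ y : e d y -> P d y <-> P d z.
  move=> dy; have yd : y <> d by move=> yd; rewrite yd e_irr in dy.
  case: (eqVneq y a) => [ya|/eqP ya].
    by apply: iff_trans (bcdz _ _) => //; apply: stepP => //; split; congruence.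
  case: (eqVneq y b) => [yb|/eqP yb].
    by apply: iff_trans (acdz _ _) => //; apply: stepP => //; split; congruence.
  by apply: iff_trans (abdz _ _) => //; apply: stepP => //; split; congruence.
move=> x y xy; case: (cover x y xy) => [[]|?|?]; subst.
- exact: tri.
- exact: d_.
- by rewrite symP; apply: d_; rewrite e_sym.
Qed.

(** Among any three vertices of a 5-cycle two are consecutive, so each edge misses some side;
    disjointness in turn links the five sides in a cycle. *)
Lemma in_G3_connected : in_G3 e -> edge_connected e.
Proof.
case/located_of_in_family=> // a [b [c [d [z [s_uniq /and5P[/= ab bc cd dz /andP[za _]] _ outE]]]]].
have [[? ? ? ?] [[? bd ?] [? ? ?]]] := (uniq5P _ _ _ _ _).1 s_uniq.
have cover x y : e x y -> x \in [:: a; b; c; d; z].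
  by move=> xy; apply/negPn/negP => /(outE x y xy)[i []].
apply: (@edge_connected_hub d z) => P symP stepP.
have abdz : P a b <-> P d z by apply: stepP => //; split; congruence.
have bcdz : P b c <-> P d z by apply: stepP => //; split; congruence.
have cddz : P c d <-> P d z.
  by apply: iff_trans abdz; apply: stepP => //; split; congruence.
have zadz : P z a <-> P d z.
  by apply: iff_trans bcdz; apply: stepP => //; split; congruence.
move=> x y xy; have yx := xy; rewrite e_sym in yx.
have x_neq : x <> y by move=> xE; rewrite xE e_irr in xy.
move: (cover x y xy) (cover y x yx); rewrite !inE.
have go u v : e u v -> P u v <-> P d z -> apart x y u v -> P x y <-> P d z.
  by move=> uv <-; apply: stepP.
do 4?case/orP; move=> /eqP ?; subst x; do 4?case/orP; move=> /eqP ?; subst y => //;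
  first [by apply: (go a b ab abdz); split; congruence
        |by apply: (go b c bc bcdz); split; congruence
        |by apply: (go c d cd cddz); split; congruence
        |by apply: (go d z dz); split; congruence
        |by apply: (go z a za zadz); split; congruence].
Qed.

(** Each edge at the common vertex [c] misses one of [ab] and [dz], and these two are disjoint. *)
Lemma bowtie_connected : graph_iso e bowtie -> edge_connected e.
Proof.
move/in_family_rigid/located_of_in_family => /(_ isT).
case=> a [b [c [d [z [s_uniq /and5P[/= ab bc ac cd /and3P[dz cz _]] edgeE outE]]]]].
have [[? ? ? ?] [[? bd ?] [? ? ?]]] := (uniq5P _ _ _ _ _).1 s_uniq.
apply: (@edge_connected_hub d z) => P symP stepP.
have abdz : P a b <-> P d z by apply: stepP => //; split; congruence.
have go u v : e u v -> P u v <-> P d z ->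
    forall x y, e x y -> apart x y u v -> P x y <-> P d z.
  by move=> uv uvE x y xy xyuv; apply: iff_trans uvE; apply: stepP.
move=> x y xy; have yx := xy; rewrite e_sym in yx.
have [i [i5 xE]] : exists i, (i < 5)%N /\ x = nth a [:: a; b; c; d; z] i.
  case xs: (x \in [:: a; b; c; d; z]); last by have [i []] := outE x y xy (negbT xs).
  by move/(nthP a): xs => [i i5 <-]; exists i.
have [j [j5 yE]] : exists j, (j < 5)%N /\ y = nth a [:: a; b; c; d; z] j.
  case ys: (y \in [:: a; b; c; d; z]); last by have [k []] := outE y x yx (negbT ys).
  by move/(nthP a): ys => [j j5 <-]; exists j.
subst x y; have := edgeE i j i5 j5 xy.
case: i {i5} xy yx => [|[|[|[|[|i]]]]] //; case: j {j5} => [|[|[|[|[|j]]]]] //= xy yx _;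
  first [by apply: (go a b ab abdz) => //; split; congruence
        |by apply: (go d z dz) => //; split; congruence].
Qed.

(** Edges in different components are disjoint; an edge in the component of the hub is reached
    through the edge [r2 l] of the other one. *)
Lemma two_components_connected : n_comp e V = 2%N -> edge_connected e.
Proof.
have conn_sym : connect_sym e by apply: sym_connect_sym.
move=> n2; have /eqP/cards2P[r1 [r2 [r12 rE]]] : #|[set x | roots e x]| = 2%N.
  by rewrite -n2; apply: eq_card => x; rewrite !inE andbT.
have rootE x : fingraph.root e x = r1 \/ fingraph.root e x = r2.
  by apply/set2P; rewrite -rE inE roots_root.
have [rr1 rr2] : fingraph.root e r1 = r1 /\ fingraph.root e r2 = r2.
  by split; apply/eqP; have := set21 r1 r2; have := set22 r1 r2; rewrite -rE !inE.
have edge_root x y : e x y -> fingraph.root e x = fingraph.root e y.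
  by move=> xy; apply/eqP; rewrite root_connect // connect1.
have [k rk] := e_noisol r1; have [l rl] := e_noisol r2.
have rkE := edge_root _ _ rk; have rlE := edge_root _ _ rl; move/eqP in r12.
apply: (@edge_connected_hub r1 k) => P symP stepP x y xy.
have xyE := edge_root _ _ xy; have [x1|x2] := rootE x.
  apply: (@iff_trans _ (P r2 l)); apply: stepP => //; split; congruence.
by apply: stepP => //; split; congruence.
Qed.

Lemma listed_connected : listed_graph e -> edge_connected e.
Proof.
case=> [[n2 _]|[]]; first exact: two_components_connected.
- exact: in_G1_connected.
- exact: in_G2_connected.
- exact: in_G3_connected.
- exact: bowtie_connected.
Qed.

End Connected.

(** * Graphs with two components *)

Section TwoShapes.
Variables (V : finType) (e : rel V).
Hypotheses (e_sym : symmetric e) (e_irr : irreflexive e).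

(** In the star case [u] is the center, and the leaf [v] guarantees [n >= 1]. *)
Definition triangle_or_star (A : pred V) :=
  (exists a b c, [/\ A =i [:: a; b; c], e a b, e b c & e a c]) \/
  (exists u v, [/\ A u, A v, u <> v &
     forall x y, A x -> A y -> e x y = ((x == u) != (y == u))]).

Lemma triangle_or_star_center A : triangle_or_star A ->
  exists2 u, A u & forall x, A x -> connect e u x.
Proof.
case=> [[a [b [c [AE ab bc ac]]]]|[u [v [Au Av _ AE]]]].
  exists a => [|x Ax]; first by have := AE a; rewrite !inE eqxx => /idP.
  have := AE x; rewrite !inE -[_ \in A]/(A x) Ax => /esym/or3P[]/eqP->;
  by [exact: connect0 | exact: connect1].
exists u => // x Ax; case: (eqVneq x u) => [->|xu]; first exact: connect0.
by apply: connect1; rewrite AE // eqxx (negbTE xu).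
Qed.

Lemma triangle_or_star_iso (A P : pred V) : P =i A -> triangle_or_star A ->
  graph_iso (induced e P) (@complete_graph 3) \/
    exists2 n : nat, (1 <= n)%N & graph_iso (induced e P) (@star_graph n).
Proof.
move=> PA [[a [b [c [AE ab bc ac]]]]|[u [v [Au Av uv AE]]]]; [left|right].
  have neq x y : e x y -> x != y by apply: contraTneq => ->; rewrite e_irr.
  apply: (@induced_iso_seq _ _ _ _ _ a [:: a; b; c]) => // [|x|].
  - by rewrite /= !inE negb_or !neq.
  - by rewrite PA AE.
  rewrite /complete_graph => -[[|[|[|//]]] ?] [[|[|[|//]]] ?] /=;
  by rewrite ?e_irr // ?ab ?bc ?ac // e_sym ?ab ?bc ?ac.
pose L := enum [pred x | A x & x != u].
have uL : u \notin L by rewrite mem_enum inE eqxx andbF.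
exists (size L).
  have : v \in L by rewrite mem_enum inE Av eq_sym; apply/eqP.
  by case: L {uL}.
apply: (@induced_iso_seq _ _ _ _ _ u (u :: L)) => // [|x|i j].
- by rewrite cons_uniq uL enum_uniq.
- by rewrite PA inE mem_enum !inE; case: eqP => [->|_] /=;
  rewrite ?andbT ?orbF //; apply/idP.
have nth0 (k : 'I_(size L).+1) : (nth u (u :: L) k == u) = (k == ord0).
  by rewrite -[X in _ == X]/(nth u (u :: L) 0) nth_uniq //= uL enum_uniq.
have nthA (k : 'I_(size L).+1) : A (nth u (u :: L) k).
  have : nth u (u :: L) k \in u :: L by rewrite mem_nth.
  by rewrite inE mem_enum inE => /predU1P[->|/andP[]].
by rewrite AE // !nth0.
Qed.

(** The closed set and its complement are each reached from a center, so two vertices are connected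
    exactly when they lie on the same side. *)
Lemma two_shapes (A : pred V) : (forall x y, e x y -> A x -> A y) ->
  triangle_or_star A -> triangle_or_star (predC A) -> two_K3_or_star_components e.
Proof.
move=> closedA shA shC.
have conn_sym : connect_sym e by apply: sym_connect_sym.
have closed x y : e x y -> A x = A y.
  by move=> xy; apply/idP/idP; apply: closedA; rewrite // e_sym.
have connA x y : connect e x y -> A x = A y.
  case/connectP=> p pth ->; elim: p x pth => //= z p IH x /andP[xz /IH <-].
  exact: closed.
have [u Au uE] := triangle_or_star_center shA.
have [w Aw wE] := triangle_or_star_center shC.
have conn x y : connect e x y = (A x == A y).
  apply/idP/eqP => [/connA//|]; case Ax: (A x) => /esym Ay.
    by apply: (connect_trans (y := u)); [rewrite conn_sym|]; apply: uE.
  by apply: (connect_trans (y := w)); [rewrite conn_sym|]; apply: wE; rewrite /= ?Ax ?Ay.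
split=> [|x].
  (* Components are counted as those of the two centers [u] and [w]. *)
  have -> : n_comp e V = n_comp e (closure e (pred2 u w)).
    apply: eq_n_comp_r => z; apply/esym/existsP; case Az: (A z).
      by exists u; rewrite !inE eqxx andbT conn Az Au.
    by exists w; rewrite !inE eqxx orbT andbT conn Az; move: Aw => /= /negbTE->.
  by rewrite n_comp_closure2 // conn Au; move: Aw => /= /negbTE->.
case Ax: (A x).
  by apply: triangle_or_star_iso shA => y; rewrite !inE conn Ax.
by apply: triangle_or_star_iso shC => y; rewrite !inE conn Ax; case: (A y).
Qed.
End TwoShapes.

(** * Classification *)

Section Classification.
Variables (V : finType) (e : rel V).
Hypotheses (e_sym : symmetric e) (e_irr : irreflexive e) (e_noisol : no_isolated e).

Lemma adj_neq x y : e x y -> x <> y.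
Proof. by move=> xy xyE; rewrite xyE e_irr in xy. Qed.

Lemma in5 (s : seq V) a b c d z x : s = [:: a; b; c; d; z] ->
  x \notin s -> [/\ x <> a, x <> b & x <> c] /\ x <> d /\ x <> z.
Proof.
move=> ->; rewrite !inE !negb_or.
by do 4![case/andP=> /eqP ?]; move/eqP=> ?.
Qed.

(** Of the ten pairs of labels, the cover excludes 13, 15, 35 and the non-edge [bd] excludes 24; the
    required path and the optional 14, 25 remain. *)
Lemma in_G1I a b c d z : uniq [:: a; b; c; d; z] ->
  e a b -> e b c -> e c d -> e d z -> e b d = false ->
  (forall x y, e x y -> [\/ x = b, x = d, y = b | y = d]) -> in_G1 e.
Proof.
move=> s_uniq ab bc cd dz bd cover.
have [[? ? ? ?] [[? ? ?] [? ? ?]]] := (uniq5P _ _ _ _ _).1 s_uniq.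
apply: (@in_family_of_located _ _ _ _ _ _ _ a b c d z) => //; split=> //.
- by rewrite /= ab bc cd dz.
- case=> [|[|[|[|[|i]]]]] // [|[|[|[|[|j]]]]] // _ _ /=; rewrite ?inE // => xy;
  exfalso; have := adj_neq xy; have yx := etrans (e_sym _ _) xy;
  by case: (cover _ _ xy); congruence.
move=> x y xy /(in5 erefl)[[? ? ?] [? ?]].
by case: (cover x y xy) => // ->; [exists 1%N|exists 3%N].
Qed.

Lemma in_G2I a b c d z : uniq [:: a; b; c; d; z] ->
  e a b -> e b c -> e a c -> e c d -> e d z -> (forall x, e z x -> x = d) ->
  (forall x y, e x y -> x \notin [:: a; b; c; d; z] -> y = d) -> in_G2 e.
Proof.
move=> s_uniq ab bc ac cd dz zd outd.
have [[? ? ? ?] [[? ? ?] [? ? ?]]] := (uniq5P _ _ _ _ _).1 s_uniq.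
apply: (@in_family_of_located _ _ _ _ _ _ _ a b c d z) => //; split=> //.
- by rewrite /= ab bc ac cd dz.
- case=> [|[|[|[|[|i]]]]] // [|[|[|[|[|j]]]]] // _ _ /=; rewrite ?inE // => xy;
  exfalso; have := adj_neq xy; have yx := etrans (e_sym _ _) xy;
  by [congruence|have := zd _ xy; congruence|have := zd _ yx; congruence].
by move=> x y xy xs; exists 3%N; rewrite (outd x y xy xs).
Qed.

Lemma in_G3I a b c d z : uniq [:: a; b; c; d; z] ->
  e a b -> e b c -> e c d -> e d z -> e z a ->
  (forall x, x \in [:: a; b; c; d; z]) -> in_G3 e.
Proof.
move=> s_uniq ab bc cd dz za sV.
apply: (@in_family_of_located _ _ _ _ _ _ _ a b c d z) => //; split=> //.
- by rewrite /= ab bc cd dz za.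
- case=> [|[|[|[|[|i]]]]] // [|[|[|[|[|j]]]]] // _ _ /=; rewrite ?inE // => xy;
  by exfalso; apply: (adj_neq xy).
by move=> x y _; rewrite sV.
Qed.

Hypotheses (no3 : no_3matching e) (ext : edges_extend e).

(* Closes the goal when uv, ws and pq would be three disjoint edges. *)
Ltac three u v w s p q := exfalso; apply: (@no3 u v w s p q);
  first [done | by rewrite e_sym | by split; congruence].

(** * Graphs covered by two vertices *)

Definition two_cover u w :=
  forall x y, e x y -> x <> u -> x <> w -> y = u \/ y = w.

(** A common neighbour [c] of [u] and [w] extends to a walk [a u c w d], which gives G_1 when
    [a <> d]. If [a = d], either a further vertex replaces one end or [G] is C_4. Without a common
    neighbour there are two stars, centered at [u] and [w]. *)
Lemma two_cover_listed u w : two_cover u w ->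
  (exists x : V, True) ->
  listed_graph e \/ graph_iso e (@cycle_graph 4).
Proof.
move=> cov0 [v0 _].
have cover x y : e x y -> [\/ x = u, x = w, y = u | y = w].
  move=> xy; case: (eqVneq x u) => [->|/eqP xu]; first by constructor 1.
  case: (eqVneq x w) => [->|/eqP xw]; first by constructor 2.
  by case: (cov0 x y xy xu xw); [constructor 3|constructor 4].
(* An edge [uw] would meet every edge, against [ext]. *)
have uw : e u w = false.
  apply/negP => /ext[p [q [/cover pq [? ? ? ?]]]].
  by case: pq; congruence.
have u_neq_w : u <> w.
  move=> uwE; subst w; have [v uv] := e_noisol u.
  have [p [q [/cover pq [? ? ? ?]]]] := ext uv.
  by case: pq; congruence.
have wu : e w u = false by rewrite e_sym.
case: (boolP [exists c, e u c && e w c]) => [/existsP[c /andP[uc wc]]|/existsPn nc].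
  have cu : e c u by rewrite e_sym.
  have cw : e c w by rewrite e_sym.
  have := adj_neq uc; have := adj_neq wc => w_c u_c.
  (* An edge disjoint from [uc] must contain [w]; [d] is its other end. The vertex [a] arises in the
     same way from [wc]. *)
  have [d [wd dc]] : exists d, e w d /\ d <> c.
    have [p [q [pq [? ? ? ?]]]] := ext uc; have qp := pq; rewrite e_sym in qp.
    case: (cover p q pq) => ?; subst; try congruence.
      by exists q; split; congruence.
    by exists p; split; congruence.
  have [a [ua ac]] : exists a, e u a /\ a <> c.
    have [p [q [pq [? ? ? ?]]]] := ext wc; have qp := pq; rewrite e_sym in qp.
    case: (cover p q pq) => ?; subst; try congruence.
      by exists q; split; congruence.
    by exists p; split; congruence.
  have := adj_neq wd; have := adj_neq ua => u_a w_d.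
  have G1 x y : e u x -> e w y -> x <> y -> x <> c -> y <> c -> in_G1 e.
    move=> ux wy xy xc yc; have := adj_neq ux; have := adj_neq wy => w_y u_x.
    apply: (@in_G1I x u c w y) => //; try by rewrite e_sym.
    by apply/uniq5P; do !split; congruence.
  case: (eqVneq a d) => [ad|/eqP ad]; last by left; right; constructor 1; apply: (G1 a d).
  subst d; case: (boolP [exists x, x \notin [:: u; c; w; a]])
    => [/existsP[x]|/existsPn sV].
    rewrite !inE !negb_or => /and4P[/eqP xu /eqP xc /eqP xw /eqP xa].
    left; right; constructor 1; have [y xy] := e_noisol x.
    have yx := xy; rewrite e_sym in yx.
    case: (cov0 x y xy xu xw) => ?; subst y.
      by apply: (G1 x a) => //; congruence.
    by apply: (G1 a x) => //; congruence.
  right; have caF : e c a = false.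
    by apply/negP => /cover[]; congruence.
  have acF : e a c = false by rewrite e_sym.
  have [au aw] : e a u /\ e a w by rewrite ![e a _]e_sym.
  apply: (@graph_iso_seq _ _ _ _ u [:: u; c; w; a]) => // [|x|].
  - by rewrite /= !inE !negb_or -!andbA andbT; do 5![apply/andP; split;
    first (apply/eqP; congruence)]; apply/eqP; congruence.
  - by have := sV x; rewrite negbK.
  case=> [[|[|[|[|i]]]] // ?] [[|[|[|[|j]]]] // ?] /=; rewrite /cycle_graph /=;
  by rewrite ?e_irr ?uw ?wu ?cu ?uc ?wc ?cw ?acF ?caF ?au ?ua ?aw ?wd.
left; left; pose A := [pred x | (x == u) || e u x].
have {}nc x : e u x -> e w x -> False by move=> ux wx; move: (nc x); rewrite ux wx.
have uV v : e u v -> forall y, e v y -> y = u.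
  move=> uv y vy; have := adj_neq uv => u_v.
  case: (cov0 v y vy) => [||//|yw]; try congruence.
  by exfalso; apply: (nc v) => //; rewrite e_sym -yw.
apply: (@two_shapes _ _ e_sym e_irr A) => [x y xy /predU1P[xu|ux]| |].
- by rewrite /A /= -xu xy orbT.
- by rewrite /A /= (uV x ux y xy) eqxx.
- right; have [v uv] := e_noisol u; exists u, v; split=> //=.
  + by rewrite eqxx.
  + by rewrite uv orbT.
  + exact: adj_neq.
  move=> x y /predU1P[->|ux] /predU1P[->|uy]; rewrite ?eqxx ?e_irr //.
  + by rewrite uy (introF eqP (nesym (adj_neq uy))).
  + by rewrite e_sym ux (introF eqP (nesym (adj_neq ux))).
  have /negbTE-> : x != u by apply: contraTneq ux => ->; rewrite e_irr.
  have /negbTE-> : y != u by apply: contraTneq uy => ->; rewrite e_irr.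
  by apply/negP => /(uV x ux) yu; rewrite yu e_irr in uy.
right; have [v wv] := e_noisol w; exists w, v.
have CA x : predC A x -> x <> w -> e w x.
  rewrite /= negb_or => /andP[/eqP xu ux] xw; have [y xy] := e_noisol x.
  rewrite e_sym; have yx := xy; rewrite e_sym in yx.
  by case: (cov0 x y xy xu xw) => ?; subst y; [rewrite yx in ux|].
have AC x : e w x -> predC A x.
  move=> wx; rewrite /= negb_or; apply/andP; split; last by apply/negP => /nc; apply.
  by apply: contraTneq wx => ->; rewrite wu.
split; [|exact: AC|exact: adj_neq|].
  by rewrite /= negb_or uw andbT eq_sym; apply/eqP.
move=> x y Ax Ay; case: (eqVneq x w) => [->|/eqP xw]; case: (eqVneq y w)
  => [->|/eqP yw] //=.
- exact: CA.
- by rewrite e_sym; apply: CA.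
apply/negP => xy; have wx := CA x Ax xw; have wy := CA y Ay yw.
have := cover x y xy; move: Ax Ay; rewrite /= !negb_or => /andP[/eqP ? _] /andP[/eqP ? _].
by case.
Qed.

(** * Five-cycles *)

Definition has_C5 := exists a b c d z,
  uniq [:: a; b; c; d; z] /\ [/\ e a b, e b c, e c d, e d z & e z a].

(** An edge at a vertex outside the cycle contains at most one cycle vertex, and the cycle without
    that vertex still has two disjoint sides: three disjoint edges in all. *)
Lemma C5_in_G3 : has_C5 -> in_G3 e.
Proof.
case=> a [b [c [d [z [s_uniq [ab bc cd dz za]]]]]].
have [[? ? ? ?] [[? ? ?] [? ? ?]]] := (uniq5P _ _ _ _ _).1 s_uniq.
apply: (in_G3I s_uniq) => // x; apply/negPn/negP => /(in5 erefl)[[? ? ?] [? ?]].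
have [y xy] := e_noisol x; have ? := adj_neq xy.
case: (eqVneq y a) => [?|/eqP ya]; first by subst y; three x a b c d z.
case: (eqVneq y b) => [?|/eqP yb]; first by subst y; three x b c d z a.
case: (eqVneq y c) => [?|/eqP yc]; first by subst y; three x c a b d z.
case: (eqVneq y d) => [?|/eqP yd]; first by subst y; three x d b c z a.
case: (eqVneq y z) => [?|/eqP yz]; first by subst y; three x z a b c d.
by three x y a b c d.
Qed.

(** * A triangle and an edge disjoint from it *)

Definition triangle_edge a b c d z :=
  [/\ e a b, e b c, e a c & e d z] /\ [/\ d <> a, d <> b & d <> c] /\
  [/\ z <> a, z <> b & z <> c].

(** Together with the flip and the swap below, the rotation generates all relabellings of the
    triangle and of the edge, so each configuration is treated for one labelling. *)
Lemma triangle_edge_rot a b c d z : triangle_edge a b c d z -> triangle_edge b c a d z.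
Proof. by case=> -[? ? ? ?] [[? ? ?] [? ? ?]]; do !split; rewrite // e_sym. Qed.

Lemma triangle_edge_flip a b c d z : triangle_edge a b c d z -> triangle_edge b a c d z.
Proof. by case=> -[? ? ? ?] [[? ? ?] [? ? ?]]; do !split; rewrite // e_sym. Qed.

Lemma triangle_edge_swap a b c d z : triangle_edge a b c d z -> triangle_edge a b c z d.
Proof. by case=> -[? ? ? ?] [[? ? ?] [? ? ?]]; do !split; rewrite // e_sym. Qed.

Lemma triangle_edge_uniq a b c d z : triangle_edge a b c d z -> uniq [:: a; b; c; d; z].
Proof.
case=> -[/adj_neq ? /adj_neq ? /adj_neq ? /adj_neq ?] [[? ? ?] [? ? ?]].
by apply/uniq5P; do !split; congruence.
Qed.

Section TriangleEdge.
Variables a b c d z : V.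
Hypothesis T : triangle_edge a b c d z.
Let s := [:: a; b; c; d; z].

(** A neighbour on the triangle would give three disjoint edges with the opposite side and [dz]; a
    neighbour off all five vertices would do so with [ab] and [dz]. *)
Lemma out_triangle x y : x \notin s -> e x y -> y = d \/ y = z.
Proof.
have [[? ? ? ?] [[? ? ?] [? ? ?]]] := (uniq5P _ _ _ _ _).1 (triangle_edge_uniq T).
have [[ab bc ac dz] _] := T => /(in5 erefl)[[? ? ?] [? ?]] xy; have ? := adj_neq xy.
case: (eqVneq y a) => [?|/eqP ya]; first by subst y; three x a b c d z.
case: (eqVneq y b) => [?|/eqP yb]; first by subst y; three x b a c d z.
case: (eqVneq y c) => [?|/eqP yc]; first by subst y; three x c a b d z.
case: (eqVneq y d) => [?|/eqP yd]; first by left.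
case: (eqVneq y z) => [?|/eqP yz]; first by right.
by three x y a b d z.
Qed.

Lemma triangle_pendant_attached :
  (forall x, e z x -> x = d) -> e c d -> in_G2 e.
Proof.
move=> zd cd; have [[ab bc ac dz] _] := T.
apply: (@in_G2I a b c d z) => //; first exact: triangle_edge_uniq T.
move=> x y xy xs; case: (out_triangle xs xy) => // yz; subst y.
have xd : x = d by apply: zd; rewrite e_sym.
by move: xs; rewrite xd !inE eqxx !orbT.
Qed.

(** Outside the triangle there are only [d] and vertices whose sole neighbour is [d]: a star at
    [d]. *)
Lemma triangle_pendant_apart :
  (forall x, e z x -> x = d) -> e a d = false -> e b d = false -> e c d = false ->
  two_K3_or_star_components e.
Proof.
move=> zd ad bd cd; have [[ab bc ac dz] _] := T.
have [[? ? ? ?] [[? ? ?] [? ? ?]]] := (uniq5P _ _ _ _ _).1 (triangle_edge_uniq T).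
pose A := [pred x | x \in [:: a; b; c]].
have nA x y : e x y -> A x -> A y.
  rewrite /= => xy xA; have yx := etrans (e_sym _ _) xy.
  apply/negPn/negP => yA.
  have yNd : y <> d.
    by move=> yd; move: xA; rewrite !inE => /or3P[]/eqP xE; congruence.
  have yNz : y <> z.
    by move=> yz; subst y; move: (zd x yx) xA; rewrite !inE => -> /or3P[]/eqP; congruence.
  have ys : y \notin s.
    move: yA; rewrite !inE !negb_or => /and3P[-> -> ->] /=.
    by apply/andP; split; apply/eqP.
  by case: (out_triangle ys yx) => ?; subst x; move: xA;
    rewrite !inE => /or3P[]/eqP; congruence.
apply: (@two_shapes _ _ e_sym e_irr A) => //; first by left; exists a, b, c.
have CA x : predC A x -> x = d \/ e d x /\ forall y, e x y -> y = d.
  rewrite /= !inE !negb_or => /and3P[xa xb xc].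
  case: (eqVneq x d) => [|xd]; [by left|right].
  case: (eqVneq x z) => [->//|xz].
  have xs : x \notin s by rewrite !inE !negb_or xa xb xc xd.
  have xdE y : e x y -> y = d.
    move=> xy; case: (out_triangle xs xy) => // ?; subst y.
    have zx := etrans (e_sym _ _) xy.
    by rewrite (zd x zx) eqxx in xd.
  have [y xy] := e_noisol x; split=> //.
  by rewrite e_sym -(xdE y xy).
right; exists d, z; split=> //.
- by rewrite /= !inE !negb_or; apply/and3P; split; apply/eqP; congruence.
- by rewrite /= !inE !negb_or; apply/and3P; split; apply/eqP; congruence.
move=> x y /CA[->|[dx xE]] /CA[->|[dy yE]]; rewrite ?eqxx ?e_irr //.
- by rewrite dy (introF eqP (nesym (adj_neq dy))).
- by rewrite e_sym dx (introF eqP (nesym (adj_neq dx))).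
rewrite (introF eqP (nesym (adj_neq dx))) (introF eqP (nesym (adj_neq dy))).
by apply/negP => /xE yd; apply: (adj_neq dy).
Qed.
End TriangleEdge.

Lemma triangle_pendant_listed a b c d z : triangle_edge a b c d z ->
  (forall x, e z x -> x = d) -> listed_graph e.
Proof.
move=> T zd; have T' := triangle_edge_rot T; have T'' := triangle_edge_rot T'.
case cd: (e c d); first by right; constructor 2; apply: triangle_pendant_attached T _ _.
case ad: (e a d); first by right; constructor 2; apply: triangle_pendant_attached T' _ _.
case bd: (e b d); first by right; constructor 2; apply: triangle_pendant_attached T'' _ _.
by left; apply: triangle_pendant_apart T _ _ _ _.
Qed.

(** The ends of [dz] attach to different corners, and the detour through the third corner closes the
    5-cycle [a c b d z]. *)
Lemma triangle_C5 a b c d z : triangle_edge a b c d z -> e d b -> e z a -> has_C5.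
Proof.
move=> T db za; have [[ab bc ac dz] _] := T.
have [[? ? ? ?] [[? ? ?] [? ? ?]]] := (uniq5P _ _ _ _ _).1 (triangle_edge_uniq T).
exists a, c, b, d, z; split; last by split; rewrite // e_sym.
by apply/uniq5P; do !split; congruence.
Qed.

(** A further edge between [{d, z}] and [{a, b}] closes a 5-cycle, and an outside vertex attached to
    [d] or [z] gives three disjoint edges; what is left is the bowtie with apex [c]. *)
Lemma triangle_apex_listed a b c d z : triangle_edge a b c d z ->
  e d c -> e z c -> listed_graph e.
Proof.
move=> T dc zc; have [[ab bc ac dz] _] := T.
have [[? ? ? ?] [[? ? ?] [? ? ?]]] := (uniq5P _ _ _ _ _).1 (triangle_edge_uniq T).
have T1 := triangle_edge_rot T; have T2 := triangle_edge_rot T1.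
have T3 := triangle_edge_flip T1; have T4 := triangle_edge_flip T2.
have G3 : has_C5 -> listed_graph e by move/C5_in_G3 => ?; right; constructor 3.
case da: (e d a); first by apply/G3/(triangle_C5 T2).
case db: (e d b); first by apply/G3/(triangle_C5 T3).
case za: (e z a); first by apply/G3/(triangle_C5 T4).
case zb: (e z b); first by apply/G3/(triangle_C5 T1).
right; constructor 4; apply: (@graph_iso_seq _ _ _ _ a [:: a; b; c; d; z]) => //.
- exact: triangle_edge_uniq T.
- move=> x; apply/negPn/negP => xs; have [y xy] := e_noisol x.
  have [[? ? ?] [? ?]] := in5 erefl xs.
  case: (out_triangle T xs xy) => ?; subst y; first by three x d z c a b.
  by three x z d c a b.
have [ba [cb [ca zd]]]
  : e b a /\ e c b /\ e c a /\ e z d by rewrite !(e_sym c) (e_sym b) (e_sym z).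
have [cd cz] : e c d /\ e c z by rewrite !(e_sym c).
have [ad [bd [az bz]]] : e a d = false /\ e b d = false /\ e a z = false /\ e b z = false.
  by rewrite !(e_sym a) !(e_sym b).
case=> [[|[|[|[|[|i]]]]] // ?] [[|[|[|[|[|j]]]]] // ?];
by rewrite /bowtie /list_graph !inE /= ?e_irr; congruence.
Qed.

(** [dzx] is a second triangle. An edge joining it to [abc], or a seventh vertex, would give three
    disjoint edges. *)
Lemma two_triangles a b c d z x : triangle_edge a b c d z ->
  x \notin [:: a; b; c; d; z] -> e d x -> e z x -> two_K3_or_star_components e.
Proof.
move=> T xs dx zx; have [[ab bc ac dz] _] := T.
have [[? ? ? ?] [[? ? ?] [? ? ?]]] := (uniq5P _ _ _ _ _).1 (triangle_edge_uniq T).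
have [[? ? ?] [? ?]] := in5 erefl xs.
pose A := [pred x | x \in [:: a; b; c]].
apply: (@two_shapes _ _ e_sym e_irr A) => [u v uv||]; first 1 last.
- by left; exists a, b, c.
- left; exists d, z, x; split=> // y; rewrite -[y \in _]/(~~ (y \in [:: a; b; c])).
  apply/idP/idP; rewrite !inE; last first.
    by case/or3P=> /eqP->; rewrite !negb_or; apply/and3P; split; apply/eqP; congruence.
  move=> yA; case: (eqVneq y d) => //= yd; case: (eqVneq y z) => //= yz.
  apply/eqP; case: (eqVneq y x) => // /eqP yx.
  have ys : y \notin [:: a; b; c; d; z].
    by move: yA; rewrite !inE !negb_or => /and3P[-> -> ->]; rewrite yd.
  have [[? ? ?] [? ?]] := in5 erefl ys.
  have [w yw] := e_noisol y.
  by case: (out_triangle T ys yw) => ?; subst w; [three y d x z a b|three y z x d a b].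
rewrite /= => uA; apply/negPn/negP => vA.
case: (eqVneq v d) => [?|/eqP vd].
  subst v; move: uA; rewrite !inE => /or3P[]/eqP ?; subst u.
  - by three a d b c z x.
  - by three b d a c z x.
  - by three c d a b z x.
case: (eqVneq v z) => [?|/eqP vz].
  subst v; move: uA; rewrite !inE => /or3P[]/eqP ?; subst u.
  - by three a z b c d x.
  - by three b z a c d x.
  - by three c z a b d x.
have vs : v \notin [:: a; b; c; d; z].
  move: vA; rewrite !inE !negb_or => /and3P[-> -> ->] /=.
  by apply/andP; split; apply/eqP.
have vu := etrans (e_sym _ _) uv.
by case: (out_triangle T vs vu) => ?; subst u; move: uA;
  rewrite !inE => /or3P[]/eqP; congruence.
Qed.

(** Unless [d] or [z] is pendant, [z] has a neighbour [p <> d] and [d] a neighbour [q <> z]. The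
    same corner gives the apex case, different corners a 5-cycle, and one corner with one outside
    vertex three disjoint edges. If both are outside they coincide and complete a second
    triangle. *)
Lemma triangle_edge_listed a b c d z : triangle_edge a b c d z -> listed_graph e.
Proof.
move=> T; have [[ab bc ac dz] _] := T.
have [[? ? ? ?] [[? ? ?] [? ? ?]]] := (uniq5P _ _ _ _ _).1 (triangle_edge_uniq T).
case: (boolP [exists p, e z p && (p != d)])
  => [/existsP[p /andP[zp /eqP pd]]|/existsPn zd]; last first.
  apply: (triangle_pendant_listed T) => x zx; apply/eqP/negPn; move: (zd x).
  by rewrite zx.
case: (boolP [exists q, e d q && (q != z)])
  => [/existsP[q /andP[dq /eqP qz]]|/existsPn dz']; last first.
  apply: (triangle_pendant_listed (triangle_edge_swap T)) => x dx;
    apply/eqP/negPn; move: (dz' x).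
  by rewrite dx.
have zNp := adj_neq zp; have dNq := adj_neq dq.
have tri_s y : y <> d -> y <> z ->
    [\/ y = a, y = b, y = c | y \notin [:: a; b; c; d; z]].
  move=> /eqP yd /eqP yz; rewrite !inE.
  case: eqP => [|_]; first by constructor 1.
  case: eqP => [|_]; first by constructor 2.
  case: eqP => [|_]; first by constructor 3.
  by constructor 4; rewrite (negbTE yd) (negbTE yz).
have T1 := triangle_edge_rot T; have T2 := triangle_edge_rot T1.
have F := triangle_edge_flip T; have F1 := triangle_edge_flip T1.
have F2 := triangle_edge_flip T2.
have G3 : has_C5 -> listed_graph e by move/C5_in_G3 => ?; right; constructor 3.
have [p_s|p_s|p_s|p_s] := tri_s p pd (nesym zNp);
  have [q_s|q_s|q_s|q_s] := tri_s q (nesym dNq) qz; try subst p; try subst q.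
- by apply: (triangle_apex_listed T1).
- by apply/G3/(triangle_C5 T).
- by apply/G3/(triangle_C5 F2).
- by have [[? ? ?] [? ?]] := in5 erefl q_s; three q d z a b c.
- by apply/G3/(triangle_C5 F).
- by apply: (triangle_apex_listed T2).
- by apply/G3/(triangle_C5 T1).
- by have [[? ? ?] [? ?]] := in5 erefl q_s; three q d z b a c.
- by apply/G3/(triangle_C5 T2).
- by apply/G3/(triangle_C5 F1).
- by apply: (triangle_apex_listed T).
- by have [[? ? ?] [? ?]] := in5 erefl q_s; three q d z c a b.
- by have [[? ? ?] [? ?]] := in5 erefl p_s; three p z d a b c.
- by have [[? ? ?] [? ?]] := in5 erefl p_s; three p z d b a c.
- by have [[? ? ?] [? ?]] := in5 erefl p_s; three p z d c a b.
have [[? ? ?] [? ?]] := in5 erefl p_s; have [[? ? ?] [? ?]] := in5 erefl q_s.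
case: (eqVneq p q) => [?|/eqP pq]; last by three p z q d a b.
by subst q; left; apply: (two_triangles T p_s).
Qed.


(** An edge disjoint from a side either misses the triangle, which is the previous case, or joins
    the opposite corner to an outside vertex. If the three outside vertices are distinct, there are
    three disjoint edges; if exactly two agree, a triangle with a disjoint edge appears; if all
    agree, there is a K_4, and any vertex beyond it again gives a triangle with a disjoint edge. *)
Lemma triangle_or_K4 a b c : e a b -> e b c -> e a c ->
  listed_graph e \/ graph_iso e (@complete_graph 4).
Proof.
move=> ab bc ac; have [ba cb ca] : [/\ e b a, e c b & e c a].
  by rewrite e_sym ab e_sym bc e_sym ac.
have := adj_neq ac; have := adj_neq bc; have := adj_neq ab => ? ? ?.
have opp u v w : e u v -> e v w -> e u w ->
    listed_graph e \/ exists x, [/\ e w x, x <> u & x <> v].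
  move=> uv vw uw; have [p [q [pq [up uq vp vq]]]] := ext uv.
  have qp := etrans (e_sym _ _) pq.
  case: (eqVneq p w) => [pw|/eqP pw]; first by right; exists q; split; congruence.
  case: (eqVneq q w) => [qw|/eqP qw]; first by right; exists p; split; congruence.
  by left; apply: (@triangle_edge_listed u v w p q); do !split=> //; apply: nesym.
have [|[x [cx xa xb]]] := opp a b c ab bc ac; first by left.
have [|[y [ay yb yc]]] := opp b c a bc ca ba; first by left.
have [|[z [bz zc za]]] := opp c a b ca ab cb; first by left.
have := adj_neq cx; have := adj_neq ay; have := adj_neq bz => ? ? ?.
case: (eqVneq x y) => [?|/eqP xy]; last first.
  case: (eqVneq x z) => [?|/eqP xz]; last first.
    case: (eqVneq y z) => [?|/eqP yz]; last by three c x a y b z.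
    subst z; left; apply: (@triangle_edge_listed a b y c x).
    by do !split; first [done|congruence].
  subst z; left; apply: (@triangle_edge_listed c b x a y).
  by do !split; first [done|congruence].
subst y; case: (eqVneq x z) => [?|/eqP xz]; last first.
  left; apply: (@triangle_edge_listed a c x b z).
  by do !split; first [done|congruence].
subst z; have [xa' xb' xc'] : [/\ e x a, e x b & e x c].
  by rewrite e_sym ay e_sym bz e_sym cx.
case: (boolP [exists w, w \notin [:: a; b; c; x]]) => [/existsP[w]|/existsPn sV].
  rewrite !inE !negb_or => /and4P[/eqP wa /eqP wb /eqP wc /eqP wx].
  have [v wv] := e_noisol w; have wNv := adj_neq wv; left.
  case: (eqVneq v a) => [?|/eqP va].
    by subst v; apply: (@triangle_edge_listed b c x w a); do !split;
      first [done|congruence].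
  case: (eqVneq v b) => [?|/eqP vb].
    by subst v; apply: (@triangle_edge_listed a c x w b); do !split;
      first [done|congruence].
  case: (eqVneq v c) => [?|/eqP vc].
    by subst v; apply: (@triangle_edge_listed a b x w c); do !split;
      first [done|congruence].
  by apply: (@triangle_edge_listed a b c w v); do !split; first [done|congruence].
right; apply: (@graph_iso_seq _ _ _ _ a [:: a; b; c; x]) => // [|w|].
- by rewrite /= !inE !negb_or -!andbA andbT; do 5![apply/andP; split;
  first (apply/eqP; congruence)]; apply/eqP; congruence.
- by have := sV w; rewrite negbK.
case=> [[|[|[|[|i]]]] // ?] [[|[|[|[|j]]]] // ?] /=; rewrite /complete_graph /=;
by rewrite ?e_irr; congruence.
Qed.

(** * Triangle-free graphs *)

Lemma triangle_free_cover a b c d :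
  (forall x y z, e x y -> e y z -> e x z -> False) ->
  e a b -> e c d -> apart a b c d ->
  (forall x, e b x -> x \in [:: a; b; c; d]) ->
  (forall x, e d x -> x \in [:: a; b; c; d]) ->
  has_C5 \/ exists u w, two_cover u w.
Proof.
move=> tf ab cd [? ? ? ?] bN dN; have := adj_neq ab; have := adj_neq cd => ? ?.
(* An outside vertex sees neither [b] nor [d] by hypothesis, and an edge wholly outside would be
   disjoint from [ab] and [cd]. *)
have outN x y : x \notin [:: a; b; c; d] -> e x y -> y = a \/ y = c.
  move=> xs xy; have yx := etrans (e_sym _ _) xy; have xNy := adj_neq xy.
  case: (boolP (y \in [:: a; b; c; d])) => [|ys].
    rewrite !inE => /or4P[]/eqP ?; [by left| |by right|]; subst y.
      by move/negP: xs => []; apply: bN.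
    by move/negP: xs => []; apply: dN.
  move: xs ys; rewrite !inE !negb_or => /and4P[/eqP ? /eqP ? /eqP ? /eqP ?].
  by case/and4P=> /eqP ? /eqP ? /eqP ? /eqP ?; three x y a b c d.
have cases x : [\/ x = a \/ x = b, x = c \/ x = d | x \notin [:: a; b; c; d]].
  rewrite !inE; do 4![case: eqP => [|_]; first by move=> ->;
    do ?[by constructor 1; auto|by constructor 2; auto]].
  by constructor 3.
(* If [bd] is not an edge, [a] and [c] already cover. *)
case bd: (e b d); last first.
  have db : e d b = false by rewrite e_sym.
  right; exists a, c => x y xy xa xc; case: (cases x) => [[|?]|[|?]|xs] //.
  - by subst x; move: (bN y xy) (adj_neq xy); rewrite !inE => /or4P[]/eqP;
    [left|..|right|]; congruence.
  - by subst x; move: (dN y xy) (adj_neq xy); rewrite !inE => /or4P[]/eqP;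
    [left|..|right|]; congruence.
  - exact: outN xs xy.
have adF : e a d = false by apply/negP => /(tf a b d ab bd).
have bcF : e b c = false by apply/negP => bc; apply: (tf b c d bc cd bd).
have [daF cbF] : e d a = false /\ e c b = false by rewrite ![e d a]e_sym ![e c b]e_sym.
(* With [bd] an edge, outside neighbours of both [a] and [c] give three disjoint edges or, when
   equal, the 5-cycle [x a b d c]. Otherwise the cover is [{a, d}] or [{b, c}]. *)
case: (boolP [exists x, (x \notin [:: a; b; c; d]) && e a x])
  => [/existsP[x /andP[xs ax]]|/existsPn aN].
  have xs' := xs; move: xs'; rewrite !inE !negb_or => /and4P[/eqP ? /eqP ? /eqP ? /eqP ?].
  case: (boolP [exists y, (y \notin [:: a; b; c; d]) && e c y])
    => [/existsP[y /andP[ys cy]]|/existsPn cN].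
    move: ys; rewrite !inE !negb_or => /and4P[/eqP ? /eqP ? /eqP ? /eqP ?].
    case: (eqVneq x y) => [?|/eqP xy]; last by three a x b d c y.
    subst y; left; exists x, a, b, d, c; split; last by split; rewrite // e_sym.
    by apply/uniq5P; do !split; congruence.
  right; exists a, d => u v uv ua ud; case: (cases u) => [[|?]|[?|]|us] //.
  - by subst u; move: (bN v uv) (adj_neq uv); rewrite !inE => /or4P[]/eqP;
    [left|..|right]; congruence.
  - subst u; have := cN v; rewrite uv andbT negbK !inE => /or4P[]/eqP ?; subst v.
    + by left.
    + by rewrite uv in cbF.
    + by rewrite e_irr in uv.
    + by right.
  - have [->|vc] := outN u v us uv; first by left.
    by have := cN u; rewrite us e_sym -vc uv.
right; exists b, c => u v uv ub uc; case: (cases u) => [[?|]|[|?]|us] //.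
- subst u; have := aN v; rewrite uv andbT negbK !inE => /or4P[]/eqP ?; subst v.
  + by rewrite e_irr in uv.
  + by left.
  + by right.
  + by rewrite uv in adF.
- by subst u; move: (dN v uv) (adj_neq uv); rewrite !inE => /or4P[]/eqP;
  [..|left|right|]; congruence.
- have [va|->] := outN u v us uv; last by right.
  by have := aN u; rewrite us e_sym -va uv.
Qed.

(** Each of two disjoint edges has an end with no neighbour outside the four vertices: outside
    neighbours of both ends would coincide and close a triangle, or differ and give three disjoint
    edges with the other edge. Such ends are the [b] and [d] of [triangle_free_cover]. *)
Lemma triangle_free_listed a b c d :
  (forall x y z, e x y -> e y z -> e x z -> False) ->
  e a b -> e c d -> apart a b c d ->
  listed_graph e \/ graph_iso e (@cycle_graph 4).
Proof.
move=> tf ab cd abcd.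
have final : has_C5 \/ (exists u w, two_cover u w) -> listed_graph e \/ graph_iso e (@cycle_graph 4).
  case=> [/C5_in_G3 G3|[u [w]]]; first by left; right; constructor 3.
  by move/two_cover_listed; apply; exists a.
apply: final.
have one_end u v w s : e u v -> e w s -> apart u v w s ->
    (forall x, e u x -> x \in [:: u; v; w;
      s]) \/ (forall x, e v x -> x \in [:: u; v; w; s]).
  move=> uv ws [? ? ? ?]; have := adj_neq uv; have := adj_neq ws => ? ?.
  case: (boolP [exists x, e u x && (x \notin [:: u; v; w; s])])
    => [/existsP[x /andP[ux xs]]|/existsPn uN]; last first.
    by left=> x ux; apply/negPn/negP => xs; have := uN x; rewrite ux xs.
  right=> y vy; apply/negPn/negP => ys.
  case: (eqVneq x y) => [?|/eqP xy].
    by subst y; apply: (tf u v x).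
  move: xs ys; rewrite !inE !negb_or => /and4P[/eqP ? /eqP ? /eqP ? /eqP ?].
  by case/and4P=> /eqP ? /eqP ? /eqP ? /eqP ?; three u x v y w s.
have [? ? ? ?] := abcd; have ba := etrans (e_sym _ _) ab; have dc
  := etrans (e_sym _ _) cd.
have [aN|bN] := one_end a b c d ab cd abcd.
  have [|cN|dN] := one_end c d a b cd ab; first by split; congruence.
    apply: (triangle_free_cover tf ba dc) => [|x /aN|x /cN]; first by split.
      by rewrite !inE => /or4P[]->; rewrite ?orbT.
    by rewrite !inE => /or4P[]->; rewrite ?orbT.
  apply: (triangle_free_cover tf ba cd) => [|x /aN|x /dN]; first by split.
    by rewrite !inE => /or4P[]->; rewrite ?orbT.
  by rewrite !inE => /or4P[]->; rewrite ?orbT.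
have [|cN|dN] := one_end c d a b cd ab; first by split; congruence.
  apply: (triangle_free_cover tf ab dc) => [|x /bN|x /cN]; first by split.
    by rewrite !inE => /or4P[]->; rewrite ?orbT.
  by rewrite !inE => /or4P[]->; rewrite ?orbT.
apply: (triangle_free_cover tf ab cd) => // x /dN.
by rewrite !inE => /or4P[]->; rewrite ?orbT.
Qed.

Lemma classification a b c d : e a b -> e c d -> apart a b c d ->
  [\/ listed_graph e, graph_iso e (@complete_graph 4) | graph_iso e (@cycle_graph 4)].
Proof.
move=> ab cd abcd.
case: (boolP [exists x, exists y, exists z, [&& e x y, e y z & e x z]]).
  case/existsP=> x /existsP[y /existsP[z /and3P[xy yz xz]]].
  by case: (triangle_or_K4 xy yz xz); [constructor 1|constructor 2].
move/existsPn => tf; have [x y z xy yz xz||]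
  := @triangle_free_listed a b c d _ ab cd abcd.
- by have /existsPn/(_ y)/existsPn/(_ z) := tf x; rewrite xy yz xz.
- by constructor 1.
- by constructor 3.
Qed.
End Classification.

(** * The exceptional graphs K_4 and C_4 *)

Lemma graph_iso_extends (V W : finType) (e : rel V) (d : rel W) :
  graph_iso e d -> edges_extend d -> edges_extend e.
Proof.
case/graph_iso_inverse=> g [g_inj g_surj gE] ext x y.
have [i ->] := g_surj x; have [j ->] := g_surj y;
  rewrite gE => /ext[k [l [kl [? ? ? ?]]]].
by exists (g k), (g l); rewrite gE; split=> //; split=> /g_inj.
Qed.

Lemma extends_4 (d : rel 'I_4) :
  d = @complete_graph 4 \/ d = @cycle_graph 4 -> edges_extend d.
Proof.
pose o k (k4 : (k < 4)%N) := Ordinal k4.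
pose o0 := o 0%N isT; pose o1 := o 1%N isT; pose o2 := o 2%N isT; pose o3 := o 3%N isT.
move=> dE i j ij.
have try_pair k l : d k l -> [&& i != k, i != l, j != k & j != l] ->
    exists k l, d k l /\ apart i j k l.
  by move=> kl /and4P[/eqP ? /eqP ? /eqP ? /eqP ?]; exists k, l.
case: dE ij try_pair => ->; rewrite /complete_graph /cycle_graph;
case: i => [[|[|[|[|i]]]] // ?]; case: j => [[|[|[|[|j]]]] // ?] _ try_pair;
  first [by apply: (try_pair o0 o1)|by apply: (try_pair o0 o2)|by apply: (try_pair o0 o3)
        |by apply: (try_pair o1 o2)|by apply: (try_pair o1 o3)|by apply: (try_pair o2 o3)].
Qed.

(** The labels 0, 1, 2, 3 in this order form a spanning path in both models. *)
Lemma not_Cohen_Macaulay_4 (R : comNzRingType) (V : finType) (e : rel V) (d : rel 'I_4) :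
  symmetric e -> irreflexive e -> complex_dim (matching_complex e) = 1 ->
  d = @complete_graph 4 \/ d = @cycle_graph 4 -> graph_iso e d ->
  ~ Cohen_Macaulay R (matching_complex e).
Proof.
move=> e_sym e_irr dimM dE /graph_iso_inverse[g [g_inj g_surj gE]].
pose o k := g (inord k).
have sE : [:: o 0; o 1; o 2; o 3]%N = [seq g i | i <- enum 'I_4].
  apply: (@eq_from_nth _ (o 0%N)) => [|i i4]; first by rewrite size_map size_enum_ord.
  rewrite (nth_map ord0) ?size_enum_ord //.
  have -> : nth ord0 (enum 'I_4) i = inord i by rewrite -[i in LHS](@inordK 3) // nth_ord_enum.
  by case: i i4 => [|[|[|[|i]]]].
apply: (not_Cohen_Macaulay_4cycle e_sym e_irr dimM (a := o 0%N) (b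
  := o 1%N) (c := o 2%N) (d := o 3%N)).
- by rewrite sE map_inj_uniq ?enum_uniq.
- by move=> x; have [i ->] := g_surj x; rewrite sE map_f // mem_enum.
- by rewrite gE; case: dE => ->;
  rewrite /complete_graph /cycle_graph -?val_eqE /= !inordK.
- by rewrite gE; case: dE => ->;
  rewrite /complete_graph /cycle_graph -?val_eqE /= !inordK.
- by rewrite gE; case: dE => ->;
  rewrite /complete_graph /cycle_graph -?val_eqE /= !inordK.
Qed.

Theorem theorem3p1 (R : comNzRingType) (V : finType) (e : rel V)
    (e_sym : symmetric e) (e_irr : irreflexive e) (e_noisol : no_isolated e)
    (dimM : complex_dim (matching_complex e) = 1) :
  (Cohen_Macaulay R (matching_complex e) <-> listed_graph e) /\
  (Buchsbaum R (matching_complex e) <->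
     [\/ listed_graph e, graph_iso e (@complete_graph 4)
       | graph_iso e (@cycle_graph 4)]).
Proof.
have BE := Buchsbaum_matching e_sym e_irr dimM R.
have no3 := matching_le2 e_sym e_irr dimM.
have [a [b [c [d [ab cd abcd]]]]] := two_apart_edges dimM.
have classif ext := classification e_sym e_irr e_noisol no3 ext ab cd abcd.
have listedCM : listed_graph e -> Cohen_Macaulay R (matching_complex e).
  move=> le; apply: Cohen_Macaulay_matching => //.
  exact: listed_connected.
split; split.
- move=> CM; have [/BE/classif[//|iso4|iso4] _] := CM; exfalso.
    by apply: (not_Cohen_Macaulay_4 _ _ dimM _ iso4 CM) => //; left.
  by apply: (not_Cohen_Macaulay_4 _ _ dimM _ iso4 CM) => //; right.
- exact: listedCM.
- by move/BE/classif.
case=> [/listedCM[]//|iso4|iso4]; apply/BE/(graph_iso_extends iso4); apply: extends_4.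
  by left.
by right.
Qed.
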